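(* Let $k \ge 2$ and $d \ge 1$ be integers. Then there exists $v_0$ such that for every integer $v\ge v_0$ with $$v-1 \equiv 0 \pmod{k-1} \quad\text{and}\quad v(v-1)\equiv 0 \pmod{k(k-1)},$$ there exists a PBD$(v,\{k\})$ of dimension at least $d$.
   Context: For $K \subseteq \mathbb{Z}_{\ge 2}$, a pairwise balanced design PBD$(v,K)$ is a pair $(X,\mathcal{B})$ where $X$ is a set of $v$ points and $\mathcal{B}$ is a collection of subsets of $X$ (blocks) with $|B|\in K$ for all $B\in\mathcal{B}$, such that any two distinct points of $X$ lie together in exactly one block. A subspace of $(X,\mathcal{B})$ is a subset $X'\subseteq X$ such that every block containing two distinct points of $X'$ is contained in $X'$; it is proper if $X'\neq X$. The subspace generated by $Y\subseteq X$ is the intersection of all subspaces containing $Y$. The PBD has dimension at least $d$ if every set of at most $d$ points generates a proper subspace (equivalently, is contained in a proper subspace). *)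

(* Defs.v *)
From mathcomp Require Import all_boot.
Set Implicit Arguments. Unset Strict Implicit. Unset Printing Implicit Defensive.

Definition is_PBD_k (v k : nat) (B : {set {set 'I_v}}) : Prop :=
  (forall b, b \in B -> #|b| = k) /\
  (forall x y : 'I_v, x != y ->
     exists! b, b \in B /\ x \in b /\ y \in b).

Definition is_subspace (v : nat) (B : {set {set 'I_v}}) (X' : {set 'I_v}) : Prop :=
  forall b, b \in B ->
    forall x y : 'I_v, x != y -> x \in X' -> y \in X' -> x \in b -> y \in b ->
      b \subset X'.

Definition dim_at_least (v : nat) (B : {set {set 'I_v}}) (d : nat) : Prop :=
  forall Y : {set 'I_v}, #|Y| <= d ->
    exists X' : {set 'I_v}, [/\ is_subspace B X', X' != setT & Y \subset X'].

(* Main.v *)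
Require Import Defs.
From mathcomp Require Import all_boot all_order all_fingroup all_solvable all_algebra all_field.
From mathcomp Require Import zify ring.
Set Implicit Arguments. Unset Strict Implicit. Unset Printing Implicit Defensive.
Import GRing.Theory.

(** Write [GD k u g] for the existence of a group divisible design with blocks
    of size [k] and [u] groups of size [g].  For fixed [g] the set of such [u] is
    closed under replacing the blocks of a linear space, and a block design on
    [(k - 1) r + 1] points is the same as [GD k r (k - 1)].

    Modulo the span of the [k]-cliques of a complete multipartite graph, an edge
    [xy] is congruent to [h x + h y + t] with [(k - 1) h = 0] and ['C(k, 2) t = 0];
    hence under the divisibility conditions the graph is an integral combination of
    [k]-cliques.  Adding multiples of the sum of all cliques makes the weights
    nonnegative and covers every edge [q] times, where [q] may be any large prime
    power in a suitable class.  Such a [q]-fold covering lifts to an exact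
    decomposition after multiplying the points by the polynomials of degree less
    than [k] over the field with [q] elements: the [q] cliques on an edge are told
    apart by the value of a difference of polynomials at a point attached to that
    edge.  Together with cyclotomic difference families this gives block designs in
    every admissible residue class to every modulus, and, through truncated
    transversal designs, two full residue classes [r = 0, 1] modulo some [L].

    Finally take the affine space of dimension [d + 1] over a field with
    [q = 1] modulo [L] elements, inflate every point by a factor [n] and truncate
    the fibre of the origin to [t] points.  All lines and fibres then have sizes for
    which a design is known, every large admissible [r] has the form
    [(q ^ (d + 1) - 1) n + t], and the hyperplanes through the origin lift to proper
    subspaces, so any [d] points lie in one. *)

(** * Clique decompositions of graphs *)

Definition clique_dec (k : nat) (T : finType) (E : rel T) (B : {set {set T}}) : Prop :=
  [/\ forall b, b \in B -> #|b| = k,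
      forall b x y, b \in B -> x \in b -> y \in b -> x != y -> E x y,
      forall x y, x != y -> E x y -> exists2 b, b \in B & x \in b /\ y \in b
    & forall b b' x y, b \in B -> b' \in B -> x != y ->
        x \in b -> y \in b -> x \in b' -> y \in b' -> b = b'].

Definition decomposable k (T : finType) (E : rel T) := exists B, clique_dec k E B.

Definition GD k u g := decomposable k (fun x y : 'I_u * 'I_g => x.1 != y.1).

(** Each edge of [E] comes from an edge of exactly one piece, so pushing the decompositions of the
    pieces forward partitions all edges. The family of blocks is explicit because the dimension
    argument needs the shape of the blocks. *)
Lemma clique_dec_glue k (T J : finType) (T' : J -> finType) (f : forall j, T' j -> T)
    (E : rel T) (E' : forall j, rel (T' j)) (B' : forall j, {set {set T' j}}) :
  (forall j, injective (f j)) ->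
  (forall j, clique_dec k (E' j) (B' j)) ->
  (forall j x y, x != y -> E' j x y -> E (f j x) (f j y)) ->
  (forall x y, x != y -> E x y ->
     exists j x' y', [/\ f j x' = x, f j y' = y & E' j x' y']) ->
  (forall j1 x1 y1 j2 x2 y2, x1 != y1 -> E' j1 x1 y1 -> E' j2 x2 y2 ->
     f j1 x1 = f j2 x2 -> f j1 y1 = f j2 y2 -> j1 = j2) ->
  clique_dec k E (\bigcup_j [set [set f j x | x in b] | b : {set T' j} in B' j]).
Proof.
move=> fI decB' sound complete unique; split.
- move=> b /bigcupP[j _ /imsetP[b' b'B ->]].
  by rewrite card_imset //; case: (decB' j) => cardB' _ _ _; apply: cardB'.
- move=> b x y /bigcupP[j _ /imsetP[b' b'B ->]] /imsetP[x' xb' ->] /imsetP[y' yb' ->].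
  move=> nxy; have nxy' : x' != y' by apply: contraNneq nxy => ->.
  by apply: sound => //; case: (decB' j) => _ edgeB' _ _; apply: edgeB' b'B _ _ _.
- move=> x y nxy Exy; have [j [x' [y' [ex ey E'xy]]]] := complete x y nxy Exy.
  have nxy' : x' != y' by apply: contraNneq nxy => exy; rewrite -ex -ey exy.
  case: (decB' j) => _ _ coverB' _; have [b' b'B [xb' yb']] := coverB' _ _ nxy' E'xy.
  exists (f j @: b'); first by apply/bigcupP; exists j => //; apply/imsetP; exists b'.
  by rewrite -ex -ey; split; apply/imsetP; [exists x' | exists y'].
move=> b1 b2 x y /bigcupP[j1 _ /imsetP[b1' b1B ->]] /bigcupP[j2 _ /imsetP[b2' b2B ->]].
move=> nxy /imsetP[x1 xb1 ex1] /imsetP[y1 yb1 ey1] /imsetP[x2 xb2 ex2] /imsetP[y2 yb2 ey2].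
have n1 : x1 != y1 by apply: contraNneq nxy => e; rewrite ex1 ey1 e.
have n2 : x2 != y2 by apply: contraNneq nxy => e; rewrite ex2 ey2 e.
have E1 : E' j1 x1 y1 by case: (decB' j1) => _ edgeB' _ _; apply: edgeB' b1B _ _ _.
have E2 : E' j2 x2 y2 by case: (decB' j2) => _ edgeB' _ _; apply: edgeB' b2B _ _ _.
have ej : j1 = j2 by apply: (unique _ _ _ _ _ _ n1 E1 E2); congruence.
(* The points and the block over [j1] have types depending on [j1], so they are generalised before
   [j1] is replaced by [j2]. *)
move: ej x1 y1 b1' b1B ex1 ey1 xb1 yb1 n1 {E1} => -> x1 y1 b1' b1B ex1 ey1 xb1 yb1 n1.
have ex : x1 = x2 by apply: (fI j2); congruence.
have ey : y1 = y2 by apply: (fI j2); congruence.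
rewrite ex in xb1; rewrite ey in yb1.
by case: (decB' j2) => _ _ _ uB'; rewrite (uB' b1' b2' x2 y2).
Qed.

Lemma decomposable_glue k (T J : finType) (T' : J -> finType) (f : forall j, T' j -> T)
    (E : rel T) (E' : forall j, rel (T' j)) :
  (forall j, injective (f j)) ->
  (forall j, decomposable k (E' j)) ->
  (forall j x y, x != y -> E' j x y -> E (f j x) (f j y)) ->
  (forall x y, x != y -> E x y ->
     exists j x' y', [/\ f j x' = x, f j y' = y & E' j x' y']) ->
  (forall j1 x1 y1 j2 x2 y2, x1 != y1 -> E' j1 x1 y1 -> E' j2 x2 y2 ->
     f j1 x1 = f j2 x2 -> f j1 y1 = f j2 y2 -> j1 = j2) ->
  decomposable k E.
Proof.
move=> fI /fin_all_exists[B' decB'] sound complete unique.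
by eexists; apply: clique_dec_glue decB' sound complete unique.
Qed.

Lemma decomposable_bij k (T T' : finType) (f : T' -> T) (E : rel T) (E' : rel T') :
  bijective f -> (forall x y, x != y -> E (f x) (f y) = E' x y) ->
  decomposable k E' -> decomposable k E.
Proof.
move=> fB fE decE'; have [g fK gK] := fB.
apply: (@decomposable_glue k T unit (fun=> T') (fun=> f) E (fun=> E')) => //.
- by move=> _; apply: bij_inj.
- by move=> _ x y nxy; rewrite fE.
- move=> x y nxy Exy; exists tt, (g x), (g y); rewrite !gK -fE ?gK //.
  by apply: contraNneq nxy => e; rewrite -(gK x) e gK.
- by move=> [] ? ? [].
Qed.

Lemma decomposable_family k (T J : finType) (beta : J -> {set T}) (E : rel T) :
  (forall j, #|beta j| = k) ->
  (forall j x y, x != y -> x \in beta j -> y \in beta j -> E x y) ->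
  (forall x y, x != y -> E x y -> exists j, x \in beta j /\ y \in beta j) ->
  (forall i j x y, x != y -> x \in beta i -> y \in beta i ->
      x \in beta j -> y \in beta j -> i = j) ->
  decomposable k E.
Proof.
move=> cardb sound complete unique; exists [set beta j | j in J]; split.
- by move=> b /imsetP[j _ ->].
- by move=> b x y /imsetP[j _ ->] xb yb nxy; apply: sound nxy xb yb.
- move=> x y nxy Exy; have [j xyj] := complete x y nxy Exy.
  by exists (beta j) => //; apply: imset_f.
- move=> b b' x y /imsetP[i _ ->] /imsetP[j _ ->] nxy xi yi xj yj.
  by rewrite (unique i j x y).
Qed.

(** * Group divisible designs and the filling of their groups *)

Lemma GDP k (I A : finType) :
  decomposable k (fun x y : I * A => x.1 != y.1) <-> GD k #|I| #|A|.
Proof.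
pose f (x : I * A) := (enum_rank x.1, enum_rank x.2).
pose g (x : 'I_#|I| * 'I_#|A|) := (@enum_val I I x.1, @enum_val A A x.2).
have fK : cancel f g by case=> i a; rewrite /g /f !enum_rankK.
have gK : cancel g f by case=> i a; rewrite /g /f !enum_valK.
split; apply: decomposable_bij.
- by exists g.
- by move=> x y _ /=; rewrite (inj_eq enum_rank_inj).
- by exists f.
- by move=> x y _ /=; rewrite (inj_eq enum_val_inj).
Qed.

Lemma GD_decomposable k u g (I A : finType) :
  GD k u g -> #|I| = u -> #|A| = g -> decomposable k (fun x y : I * A => x.1 != y.1).
Proof. by move=> gd cI cA; apply/GDP; rewrite cI cA. Qed.

Lemma decomposable_GD k u g (I A : finType) :
  decomposable k (fun x y : I * A => x.1 != y.1) -> #|I| = u -> #|A| = g -> GD k u g.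
Proof. by move=> gd <- <-; apply/(proj1 (GDP k I A)). Qed.

Lemma GD1P k (T : finType) :
  decomposable k (fun x y : T => x != y) <-> GD k #|T| 1.
Proof.
rewrite -(card_ord 1); split.
- move=> dec; apply/(proj1 (GDP k T 'I_1)).
  apply: (@decomposable_bij _ _ _ (fun x => (x, ord0)) _ _ _ _ dec) => //.
  by exists fst => // -[x y] /=; rewrite (ord1 y).
move/(proj2 (GDP k T 'I_1)); apply: (@decomposable_bij _ _ _ fst).
  by exists (fun x => (x, ord0)) => // -[x y] /=; rewrite (ord1 y).
by [].
Qed.

Lemma GD_k1 k : GD k k 1.
Proof.
rewrite -{2}(card_ord k); apply/GD1P.
apply: (@decomposable_family _ _ unit (fun=> setT)) => //.
- by move=> _; rewrite cardsT card_ord.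
- by move=> x y _ _; exists tt; rewrite !inE.
- by move=> [] [].
Qed.

(** One new group, indexed by [None], is adjoined to all old groups at once, and every old group
    together with it carries a copy of the small design. The description of the blocks, old ones or
    ones over a single [i], is what later shows that hyperplanes lift to subspaces. *)
Lemma clique_dec_fill k (I A0 A : finType) (B : {set {set I * (A0 * A)}}) :
  clique_dec k (fun x y : I * (A0 * A) => x.1 != y.1) B ->
  decomposable k (fun x y : option A0 * A => x.1 != y.1) ->
  exists B' : {set {set option (I * A0) * A}},
    clique_dec k (fun x y => x.1 != y.1) B' /\
    forall b, b \in B' ->
      (exists2 b0, b0 \in B & b = [set (Some (x.1, x.2.1), x.2.2) | x in b0]) \/
      (exists i, forall x j a, x \in b -> x.1 = Some (j, a) -> j = i).
Proof.
move=> decB [B1 decB1].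
pose T' (j : option I) : finType :=
  if j is Some i then (option A0 * A)%type else (I * (A0 * A))%type.
pose f (j : option I) : T' j -> option (I * A0) * A :=
  match j with
  | Some i => fun x : option A0 * A => (omap (pair i) x.1, x.2)
  | None => fun x : I * (A0 * A) => (Some (x.1, x.2.1), x.2.2)
  end.
pose E' (j : option I) : rel (T' j) :=
  match j with
  | Some i => fun x y : option A0 * A => x.1 != y.1
  | None => fun x y : I * (A0 * A) => x.1 != y.1
  end.
pose B' (j : option I) : {set {set T' j}} :=
  match j with
  | Some i => B1
  | None => B
  end.
exists (\bigcup_j [set [set f j x | x in b] | b : {set T' j} in B' j]); split.
  apply: (@clique_dec_glue k _ _ T' f _ E' B').
  - case=> [i|] /=.
      by move=> [[a|] b] [[a'|] b'] //= [] => [-> ->|->].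
    by move=> [i [a b]] [i' [a' b']] /= [-> -> ->].
  - by case.
  - case=> [i|] /=.
      move=> [[a|] b] [[a'|] b'] //= _; apply: contraNneq => -[->] //.
    by move=> [i [a b]] [i' [a' b']] /= _; apply: contraNneq => -[->].
  - move=> [[[i a]|] b] [[[i' a']|] b'] //= _ nxy.
    + have [ei|ni] := eqVneq i i'.
        exists (Some i), (Some a, b), (Some a', b'); split=> //=; first by rewrite ei.
        by move: nxy; apply: contraNneq => -[->]; rewrite ei.
      by exists None, (i, (a, b)), (i', (a', b')).
    + by exists (Some i), (Some a, b), (None, b').
    + by exists (Some i'), (None, b), (Some a', b').
  - case=> [i|] /=.
      move=> [[a|] b] [[a'|] b'] [j|] //=.
      * by move=> [[c|] d] [[c'|] d'] //= _ _ _ [->].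
      * by move=> [c [d e]] [c' [d' e']] /= _ _ /eqP nc [e1 _ _] [e2 _ _]; case: nc; congruence.
      * by move=> [[c|] d] [[c'|] d'] //= _ _ _ [->].
      * by move=> [[c|] d] [[c'|] d'] //= _ _ _ _ [->].
    move=> [i [a b]] [i' [a' b']] [j|] //= [[c|] d] [[c'|] d'] //=.
    by move=> _ /eqP ni _ [e1 _ _] [e2 _ _]; case: ni; congruence.
move=> b /bigcupP[[i|] _ /imsetP[b' b'B ->]].
  right; exists i => x j a /imsetP[[[c|] e] _ ->] //= [-> _] //.
by left; exists b'.
Qed.

Lemma GD_fill k m a g : GD k m (a * g) -> GD k a.+1 g -> GD k (m * a).+1 g.
Proof.
move=> gd1 gd2.
have [|B decB] := GD_decomposable (I := 'I_m) (A := ('I_a * 'I_g)%type) gd1 (card_ord m).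
  by rewrite card_prod !card_ord.
have [|B' [decB' _]] := clique_dec_fill decB
    (GD_decomposable (I := option 'I_a) (A := 'I_g) gd2 _ (card_ord g)).
  by rewrite card_option card_ord.
by apply: (decomposable_GD (ex_intro _ B' decB')); rewrite ?card_option ?card_prod !card_ord.
Qed.

(** * Inflation and truncated transversal designs *)

(** Wilson's fundamental construction with constant weight: every point is replaced by a copy of
    [A], and the points over [beta j] carry a design whose groups are these copies. *)
Lemma clique_dec_inflate k (M A J : finType) (EM : rel M) (beta : J -> {set M}) :
  (forall j x y, x != y -> x \in beta j -> y \in beta j -> EM x y) ->
  (forall x y, x != y -> EM x y -> exists j, x \in beta j /\ y \in beta j) ->
  (forall i j x y, x != y -> x \in beta i -> y \in beta i ->
      x \in beta j -> y \in beta j -> i = j) ->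
  (forall j, GD k #|beta j| #|A|) ->
  exists B : {set {set M * A}},
    clique_dec k (fun x y : M * A => (x.1 != y.1) && EM x.1 y.1) B /\
    forall b, b \in B -> exists j, forall x, x \in b -> x.1 \in beta j.
Proof.
move=> sound complete unique gd.
pose T' (j : J) : finType := ({m | m \in beta j} * A)%type.
pose f (j : J) (x : T' j) : M * A := (val x.1, x.2).
have gd' j : decomposable k (fun x y : T' j => x.1 != y.1).
  by apply: (GD_decomposable (gd j)) => //; rewrite card_sig.
have [B' decB'] := fin_all_exists gd'.
exists (\bigcup_j [set [set f j x | x in b] | b : {set T' j} in B' j]); split.
  apply: clique_dec_glue decB' _ _ _.
  - by move=> j [x a] [y b] [/val_inj -> ->].
  - move=> j [x a] [y b] _ /= nxy; rewrite (inj_eq val_inj) nxy.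
    by apply: (sound j); rewrite ?(valP x) ?(valP y) // (inj_eq val_inj).
  - move=> [x a] [y b] _ /= /andP[nxy Exy]; have [j [xj yj]] := complete x y nxy Exy.
    exists j, (exist _ x xj, a), (exist _ y yj, b); split => //=.
  - move=> i [x1 a1] [y1 b1] j [x2 a2] [y2 b2] /= _ n1 n2 [ex _] [ey _].
    apply: (unique i j (val x1) (val y1)); rewrite ?(valP x1) ?(valP y1) //.
      by have -> : val x1 = val x2 := ex; apply: valP.
    by have -> : val y1 = val y2 := ey; apply: valP.
move=> b /bigcupP[j _ /imsetP[b' b'B ->]]; exists j => x /imsetP[[y a] _ ->].
exact: (valP y).
Qed.

(** Up to sign [i - j] is a positive integer at most [s], hence a divisor of the factorial of
    [s]. *)
Lemma unit_natrB_Zp n s i j : 1 < n -> coprime n s`! -> i <= s -> j <= s -> i != j ->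
  (i%:R - j%:R : 'Z_n)%R \is a GRing.unit.
Proof.
move=> n1 co; wlog lij : i j / j < i => [hw|] le_i le_j nij.
  case: (ltngtP j i) => [lt_ji|lt_ij|e]; first exact: hw.
    by rewrite -opprB unitrN; apply: hw; rewrite // eq_sym.
  by rewrite e eqxx in nij.
rewrite -natrB 1?ltnW // unitZpE //.
by apply: coprime_dvdr co; apply: dvdn_fact; rewrite subn_gt0 lij /= (leq_trans (leq_subr _ _)).
Qed.

Section Truncated.

Variables (k : nat) (A P : finType) (o : P) (lines : {set {set P}}).
Variables (R : finComUnitRingType) (alpha : P -> R) (U : {set R}).
Hypothesis line_ex : forall x y, x != y -> exists2 l, l \in lines & x \in l /\ y \in l.
Hypothesis line_uniq : forall l l' x y, l \in lines -> l' \in lines -> x != y ->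
  x \in l -> y \in l -> x \in l' -> y \in l' -> l = l'.
Hypothesis alphaU : forall x y, x != y -> (alpha x - alpha y)%R \is a GRing.unit.
Hypothesis gdR : GD k #|R| #|A|.
Hypothesis gdU : GD k #|U| #|A|.
Hypothesis gdl : forall l, l \in lines -> GD k #|l| #|A| /\ GD k #|l :\ o| #|A|.

(** The points of the linear space on [P] inflated by [R], with the fibre of [o] cut down to [U]. *)
Definition trunc : finType := {m : P * R | (m.1 != o) || (m.2 \in U)}.

Lemma card_trunc : #|{: trunc}| = #|P|.-1 * #|R| + #|U|.
Proof.
rewrite card_sig.
have -> : #|[pred m : P * R | (m.1 != o) || (m.2 \in U)]| = #|~: setX [set o] (~: U)|.
  by apply: eq_card => m; rewrite !inE negb_and negbK.
rewrite cardsCs setCK cardsX cards1 mul1n card_prod.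
have P0 : 0 < #|P| by apply/card_gt0P; exists o.
have := cardsC U; have := subset_leq_card (subsetT U).
case: #|P| P0 => // p _ /=; rewrite -cardsT; nia.
Qed.

(** The points of [trunc] form a linear space whose blocks are the fibres and, over each line, the
    graphs of [x |-> alpha x * a + b]; two points over distinct [x] determine [a] because the
    difference of the [alpha] values is a unit. All block sizes admit a design by hypothesis, so
    this space can be inflated by [A]. *)
Lemma clique_dec_trunc : exists B : {set {set trunc * A}},
  clique_dec k (fun x y => x.1 != y.1) B /\
  forall b, b \in B ->
    (exists2 l, l \in lines & (forall x, x \in b -> (val x.1).1 \in l) /\
       forall x y, x \in b -> y \in b -> (val x.1).1 = (val y.1).1 -> x.1 = y.1) \/
    (forall x y, x \in b -> y \in b -> (val x.1).1 = (val y.1).1).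
Proof.
pose J : finType := ({l | l \in lines} * R * R + P)%type.
pose beta (j : J) : {set trunc} :=
  match j with
  | inl (l, a, b) =>
      [set m : trunc | ((val m).1 \in val l) && ((val m).2 == alpha (val m).1 * a + b)%R]
  | inr x => [set m : trunc | (val m).1 == x]
  end.
have [||||B [decB partB]] := @clique_dec_inflate k trunc A J (fun x y => x != y) beta.
- by [].
- move=> [[x y] hx] [[x' y'] hx'] nm _.
  have [ex|nx] := eqVneq x x'; first by exists (inr x); rewrite !inE /= ex.
  have [l ll [xl xl']] := line_ex nx.
  pose a := ((y - y') / (alpha x - alpha x'))%R.
  exists (inl (exist _ l ll, a, (y - alpha x * a)%R)); rewrite !inE /= xl xl' /= addrC subrK eqxx.
  have e := divrK (alphaU nx) (y - y')%R; rewrite -/a in e.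
  split=> //; apply/eqP; have -> : y' = (y - a * (alpha x - alpha x'))%R by rewrite e; ring.
  by ring.
- move=> i j [[x y] hx] [[x' y'] hx'] nm.
  have nm' : (x, y) != (x', y') by [].
  case: i => [[[l a] b]|z]; case: j => [[[l' a'] b']|z']; rewrite !inE /=; last first.
  + by move=> /eqP <- _ /eqP <-.
  + move=> /eqP ex /eqP ex' /andP[_ /eqP ey] /andP[_ /eqP ey'].
    by case/eqP: nm'; rewrite ey ey' ex ex'.
  + move=> /andP[_ /eqP ey] /andP[_ /eqP ey'] /eqP ex /eqP ex'.
    by case/eqP: nm'; rewrite ey ey' ex ex'.
  move=> /andP[xl /eqP ey] /andP[xl' /eqP ey'] /andP[xl2 /eqP ey2] /andP[xl2' /eqP ey2'].
  have nx : x != x' by apply: contraNneq nm' => ex; rewrite ey ey' ex.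
  have el : l = l' by apply: val_inj; apply: (line_uniq (valP l) (valP l') nx).
  have e : ((alpha x - alpha x') * a = (alpha x - alpha x') * a')%R.
    have h1 : ((alpha x - alpha x') * a = y - y')%R by rewrite ey ey' mulrBl opprD addrACA subrr addr0.
    have h2 : ((alpha x - alpha x') * a' = y - y')%R by rewrite ey2 ey2' mulrBl opprD addrACA subrr addr0.
    by rewrite h1 h2.
  have ea := mulrI (alphaU nx) e.
  by move: ey; rewrite ey2 el ea => /addrI ->.
- case=> [[[l a] b]|x].
  (* Truncation removes from a graph at most its point over [o], namely when the value there lies
     outside [U]; this leaves [#|l|] or [#|l :\ o|] points. *)
  + have -> : #|beta (inl (l, a, b))| =
        #|[set x in val l | (x != o) || ((alpha x * a + b)%R \in U)]|.
      rewrite -(card_in_imset (f := fun m : trunc => (val m).1)).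
        apply: eq_card => x; rewrite inE; apply/imsetP/andP.
          move=> [[[x' y'] h]]; rewrite inE /= => /andP[xl /eqP ey] ->; split=> //.
          by move: h; rewrite /= ey.
        move=> [xl h]; exists (exist _ (x, (alpha x * a + b)%R) h) => //.
        by rewrite inE /= xl eqxx.
      move=> [[x y] h] [[x' y'] h']; rewrite !inE /= => /andP[_ /eqP ey] /andP[_ /eqP ey'] ex.
      by apply: val_inj; rewrite /= ey ey' ex.
    have [gl gl'] := gdl (valP l).
    case hU: ((alpha o * a + b)%R \in U).
      rewrite (_ : [set x in _ | _] = val l) //; apply/setP => x; rewrite inE.
      by case: (eqVneq x o) => [->|]; rewrite ?hU /= andbT.
    rewrite (_ : [set x in _ | _] = val l :\ o) //; apply/setP => x; rewrite !inE andbC.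
    by case: (eqVneq x o) => [->|]; rewrite ?hU.
  + have -> : #|beta (inr x)| = #|[set y : R | (x != o) || (y \in U)]|.
      rewrite -(card_in_imset (f := fun m : trunc => (val m).2)).
        apply: eq_card => y; rewrite inE; apply/imsetP/idP.
          by move=> [[[x' y'] h]]; rewrite inE /= => /eqP <- ->.
        by move=> h; exists (exist _ (x, y) h); rewrite ?inE /=.
      move=> [[x1 y] h] [[x' y'] h']; rewrite !inE /= => /eqP e1 /eqP e2 ey.
      by apply: val_inj; rewrite /= e1 e2 ey.
    case: (eqVneq x o) => _ /=.
      by have -> : #|[set y : R | y \in U]| = #|U| by apply: eq_card => y; rewrite inE.
    by have -> : #|[set y : R | true]| = #|R| by apply: eq_card => y; rewrite !inE.
exists B; split.
  case: decB => h1 h2 h3 h4; split=> //.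
    by move=> b x y bB xb yb nxy; case/andP: (h2 _ _ _ bB xb yb nxy).
  by move=> x y nxy nxy1; apply: h3; rewrite ?nxy1.
move=> b bB; have [[[[l a] c]|x] hb] := partB b bB; [left|right].
  exists (val l); first exact: valP.
  split=> [x|x y] => [/hb|/hb + /hb]; rewrite !inE => /andP[] //.
  move=> _ /eqP e1 /andP[_ /eqP e2] e; apply: val_inj.
  by case: (val x.1) (val y.1) e e1 e2 => [x1 x2] [y1 y2] /= -> -> ->.
by move=> y z /hb + /hb; rewrite !inE => /eqP -> /eqP ->.
Qed.

End Truncated.

(** The case of a space with a single line of [s.+1] points: a transversal design with [s.+1] groups
    of size [n], one of them truncated to [t]. *)
Lemma GD_truncated_TD k g s n t : 1 < n -> coprime n s`! -> t <= n ->
  GD k s g -> GD k s.+1 g -> GD k n g -> GD k t g -> GD k (s * n + t) g.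
Proof.
move=> n1 co tn gs gs1 gn gt.
have cZ : #|{: 'Z_n}| = n by rewrite card_ord Zp_cast.
have [U cU] : exists U : {set 'Z_n}, #|U| = t.
  have /card_geqP[r [ur sr _]] : t <= #|{: 'Z_n}| by rewrite cZ.
  by exists [set x in r]; rewrite cardsE -sr; apply/card_uniqP.
have cP : #|{: 'I_s.+1}| = s.+1 by rewrite card_ord.
have [||||||B [decB _]] := @clique_dec_trunc k 'I_g 'I_s.+1 ord_max [set setT] ('Z_n)
    (fun i => (i : nat)%:R)%R U.
- by move=> x y _; exists setT; rewrite ?inE.
- by move=> l l' x y /set1P -> /set1P ->.
- by move=> x y nxy; apply: (unit_natrB_Zp (s := s)); rewrite // -ltnS ltn_ord.
- by rewrite cZ card_ord.
- by rewrite cU card_ord.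
- move=> l /set1P ->; rewrite cardsDS ?sub1set ?inE // cardsT cards1 cP subn1 card_ord.
  by split.
apply: (decomposable_GD (ex_intro _ B decB)); last by rewrite card_ord.
by rewrite card_trunc cU cZ cP.
Qed.

(** Strong induction: beyond the interval, [m] is written as [a * n + t] with [n] congruent to 1
    modulo the factorial of [a], hence coprime to it, and with [a <= t <= n], so that both [n] and
    [t] are covered by induction. *)
Lemma closed_ge_of_interval (D : nat -> Prop) a : 0 < a ->
  (forall n t, 1 < n -> coprime n a`! -> t <= n -> D a -> D a.+1 -> D n -> D t -> D (a * n + t)) ->
  (forall u, a <= u <= a * (a * a`! + a + 2 * a`!) + a -> D u) ->
  forall m, a <= m -> D m.
Proof.
move=> a0 cl base; elim/ltn_ind => m IH am.
have [mh|mh] := leqP m (a * (a * a`! + a + 2 * a`!) + a); first by apply: base; rewrite am.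
have f0 := fact_gt0 a; set F := a`! in mh f0 base *.
(* [x] is the largest integer with [a * x + a <= m], and [n] the largest one up to [x] that is 1
   modulo [F]. Thus [m - a * n] is at least [a] and less than [a * F + a], which is less than
   [n]. *)
pose x := (m - a) %/ a; pose n := (x - 1) %/ F * F + 1.
have hx1 : x * a <= m - a by apply: leq_trunc_div.
have hx2 : m - a < x.+1 * a by apply: ltn_ceil.
have hxb : a * F + a + 2 * F <= x by rewrite leq_divRL //; lia.
have hn1 : (x - 1) %/ F * F <= x - 1 by apply: leq_trunc_div.
have hn2 : x - 1 < ((x - 1) %/ F).+1 * F by apply: ltn_ceil.
have n_lo : a * F + a < n by rewrite /n; lia.
have n_le : n <= x by rewrite /n; lia.
have x_le : x.+1 <= n + F by rewrite /n; lia.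
have anm : n * a + a <= m by have := leq_mul2r a n x; lia.
have mn : m <= n * a + n by have := leq_mul (leqnn a) x_le; lia.
have -> : m = a * n + (m - a * n) by lia.
have ba : D a by apply: base; rewrite leqnn leq_addl.
have ba1 : D a.+1 by apply: base; nia.
apply: cl => //; [lia| |lia|apply: IH; nia|apply: IH; nia].
rewrite /n -/F; apply/eqP; rewrite gcdnC gcdnMDl gcdn1 //.
Qed.

(** The blocks are the graphs of [i |-> i * a + b] over the integers modulo [n]; differences of
    distinct indices below [k] are units, so two values determine [a] and [b]. *)
Lemma GD_TD k n : 1 < n -> coprime n k.-1`! -> GD k k n.
Proof.
move=> n1 co; have cZ : #|{: 'Z_n}| = n by rewrite card_ord Zp_cast.
pose beta (j : 'Z_n * 'Z_n) := [set (i, (i : nat)%:R * j.1 + j.2)%R | i : 'I_k].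
have inb i y j : ((i, y) \in beta j) = (y == (i : nat)%:R * j.1 + j.2)%R.
  by apply/imsetP/eqP => [[i' _ [-> ->]]|->] //; exists i.
have u (i i' : 'I_k) : i != i' -> ((i : nat)%:R - (i' : nat)%:R : 'Z_n)%R \is a GRing.unit.
  by move=> ni; apply: (unit_natrB_Zp (s := k.-1)); rewrite // -ltnS prednK // (leq_ltn_trans _ (ltn_ord i)).
apply: (@decomposable_GD _ _ _ 'I_k 'Z_n) => //; last by rewrite card_ord.
apply: (@decomposable_family _ _ _ beta).
- by move=> j; rewrite card_imset ?card_ord // => i i' [].
- move=> j [i y] [i' y'] nxy; rewrite !inb /= => /eqP ey /eqP ey'.
  by apply: contraNneq nxy => ei; rewrite ey ey' ei.
- move=> [i y] [i' y'] _ /= ni.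
  pose a := ((y - y') / ((i : nat)%:R - (i' : nat)%:R))%R.
  exists (a, (y - (i : nat)%:R * a)%R); rewrite !inb /= addrC subrK eqxx; split=> //.
  have e := divrK (u i i' ni) (y - y')%R; rewrite -/a in e.
  apply/eqP; have -> : y' = (y - a * ((i : nat)%:R - (i' : nat)%:R))%R by rewrite e; ring.
  by ring.
- move=> j j' [i y] [i' y'] nxy; rewrite !inb => /eqP ey /eqP ey' /eqP e2 /eqP e2'.
  have ni : i != i' by apply: contraNneq nxy => e; rewrite ey ey' e.
  have e : (((i : nat)%:R - (i' : nat)%:R) * j.1 = ((i : nat)%:R - (i' : nat)%:R) * j'.1 :> 'Z_n)%R.
    have h1 : (((i : nat)%:R - (i' : nat)%:R) * j.1 = y - y' :> 'Z_n)%R by rewrite ey ey' mulrBl opprD addrACA subrr addr0.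
    have h2 : (((i : nat)%:R - (i' : nat)%:R) * j'.1 = y - y' :> 'Z_n)%R by rewrite e2 e2' mulrBl opprD addrACA subrr addr0.
    by rewrite h1 h2.
  have ea := mulrI (u i i' ni) e; move: ey; rewrite e2 ea => /addrI.
  by case: j j' ea {e ey' e2 e2'} => [j1 j2] [j1' j2'] /= -> ->.
Qed.

Lemma GD_mul k u g n : 1 < n -> coprime n k.-1`! -> GD k u g -> GD k u (g * n).
Proof.
move=> n1 co [B [cB eB vB uB]].
have [||||B' [decB' _]] := @clique_dec_inflate k ('I_u * 'I_g)%type 'I_n {b | b \in B}
    (fun x y => x.1 != y.1) val.
- by move=> j x y nxy xj yj; apply: eB (valP j) xj yj nxy.
- by move=> x y nxy Exy; have [b bB xy] := vB x y nxy Exy; exists (exist _ b bB).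
- move=> i j x y nxy xi yi xj yj; apply: val_inj.
  exact: (uB _ _ x y (valP i) (valP j)).
- by move=> j; rewrite (cB _ (valP j)) card_ord; apply: GD_TD.
apply: (@decomposable_GD _ _ _ 'I_u ('I_g * 'I_n)%type); rewrite ?card_prod ?card_ord //.
pose f (x : 'I_u * 'I_g * 'I_n) := (x.1.1, (x.1.2, x.2)).
apply: (@decomposable_bij _ _ _ f) (ex_intro _ B' decB').
  by exists (fun x => ((x.1, x.2.1), x.2.2)); [move=> [[]]|move=> [? []]].
move=> [[i a] b] [[i' a'] b'] _ /=; case: (eqVneq i i') => [|ni]; first by rewrite andbF.
by rewrite andbT; apply/esym; apply: contra ni => /eqP[->].
Qed.

(** Numbering the points inside each fibre of [gamma] embeds [T] in [I * 'I_g], and the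
    cardinalities agree. *)
Lemma GD_of_uniform_fibers k g (T I : finType) (gamma : T -> I) :
  (forall i, #|[set x | gamma x == i]| = g) ->
  decomposable k (fun x y => gamma x != gamma y) -> GD k #|I| g.
Proof.
move=> fib dec; pose s i := enum [set x | gamma x == i].
have ss i : size (s i) = g by rewrite -cardE.
have xs x : x \in s (gamma x) by rewrite mem_enum inE.
have hs x : index x (s (gamma x)) < g by rewrite -[X in _ < X](ss (gamma x)) index_mem.
pose f x : I * 'I_g := (gamma x, Ordinal (hs x)).
have cT : #|{: I * 'I_g}| <= #|T|.
  rewrite card_prod card_ord -[#|T|]sum1_card (partition_big gamma predT) //=.
  rewrite -sum_nat_const; apply: leq_sum => i _.
  by rewrite -(fib i) -sum1_card; apply/eq_leq/eq_bigl => x; rewrite inE.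
apply: (@decomposable_GD _ _ _ I 'I_g); rewrite ?card_ord //.
apply: (@decomposable_bij _ _ _ f) dec => //.
apply: inj_card_bij cT => x y [eg ei].
by rewrite -(nth_index x (xs x)) ei eg nth_index.
Qed.

(** The blocks through the deleted point [oo] become the groups, of size [k - 1]: [gamma] sends a
    point to its block through [oo]. The other blocks meet each group at most once and remain. *)
Lemma GD_delete_point k r : 1 < k -> GD k ((k - 1) * r).+1 1 -> GD k r (k - 1).
Proof.
move=> k1; set v := ((k - 1) * r).+1; rewrite -(card_ord v) => /GD1P[B [cB eB vB uB]].
pose oo : 'I_v := ord0.
pose T' : finType := {x : 'I_v | x != oo}; pose I : finType := {b | (b \in B) && (oo \in b)}.
have [gamma gammaP] : exists gamma : T' -> I, forall x, val x \in val (gamma x).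
  apply: (@fin_all_exists T' (fun=> I) (fun x i => val x \in val i)) => x; have [b bB [xb ob]] := vB (val x) oo (valP x) (valP x).
  by exists (exist _ b (introT andP (conj bB ob))).
have gammaE (x : T') (i : I) : (gamma x == i) = (val x \in val i).
  apply/eqP/idP => [<-|xi]; first exact: gammaP.
  have /andP[gB og] := valP (gamma x); have /andP[iB oi] := valP i.
  by apply: val_inj; apply: (uB _ _ (val x) oo); rewrite ?gammaP // (valP x).
have cardT (b : {set 'I_v}) : #|[set x : T' | val x \in b]| = #|b :\ oo|.
  rewrite -(card_imset _ val_inj); apply: eq_card => x; rewrite !inE.
  apply/imsetP/andP => [[y]|[xo xb]]; first by rewrite inE => yb ->; rewrite (valP y).
  by exists (exist _ x xo); rewrite ?inE.
have fib i : #|[set x | gamma x == i]| = k - 1.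
  have /andP[iB oi] := valP i; have := cardsD1 oo (val i); rewrite oi (cB _ iB) => ->.
  by rewrite addKn -cardT; apply: eq_card => x; rewrite !inE gammaE.
have cI : #|I| = r.
  have cT : #|T'| = (k - 1) * r.
    have := cardC1 oo; rewrite card_ord /v /= => <-; rewrite card_sig.
    by apply: eq_card => x; rewrite !inE.
  apply/eqP; rewrite -(@eqn_pmul2r (k - 1)) ?subn_gt0 // [r * _]mulnC -cT.
  rewrite -sum_nat_const -[#|T'|]sum1_card (partition_big gamma predT) //=; apply/eqP.
  by apply: eq_bigr => i _; rewrite -(fib i) -sum1_card; apply: eq_bigl => x; rewrite inE.
rewrite -cI; apply: GD_of_uniform_fibers fib _.
exists [set [set x : T' | val x \in b] | b : {set 'I_v} in [set b in B | oo \notin b]]; split.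
- move=> b' /imsetP[b]; rewrite inE => /andP[bB ob] ->.
  by rewrite cardT -(cB _ bB) (cardsD1 oo b) (negPf ob).
- move=> b' x y /imsetP[b]; rewrite inE => /andP[bB ob] ->; rewrite !inE => xb yb nxy.
  apply/negP => /eqP e; move: (gammaP x); rewrite e => xg; have yg := gammaP y.
  have /andP[gB og] := valP (gamma y).
  have eb : b = val (gamma y) by apply: (uB _ _ (val x) (val y)).
  by rewrite eb og in ob.
- move=> x y nxy ng; have nv : val x != val y by [].
  have [b bB [xb yb]] := vB _ _ nv nv.
  exists [set x : T' | val x \in b]; last by rewrite !inE.
  apply/imsetP; exists b => //; rewrite inE bB /=; apply: contra ng => ob.
  have hb : (b \in B) && (oo \in b) by rewrite bB.
  have := gammaE x (exist _ b hb); rewrite /= xb => /eqP ->.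
  by have := gammaE y (exist _ b hb); rewrite /= yb => /eqP ->.
move=> b1' b2' x y /imsetP[b1 + ->] /imsetP[b2 + ->]; rewrite !inE => /andP[b1B _] /andP[b2B _].
by move=> nxy x1 y1 x2 y2; rewrite (uB b1 b2 (val x) (val y)).
Qed.

(** * Integral combinations of cliques *)

Section Signed.
Local Open Scope ring_scope.

Variables (k : nat) (I A : finType).
Local Notation T := (I * A)%type.
Local Notation V := {ffun T * T -> int}.

Definition transv (b : {set T}) := [forall x in b, forall y in b, (x != y) ==> (x.1 != y.1)].
Definition kclique (b : {set T}) := (#|b| == k) && transv b.

Lemma transvP (b : {set T}) : reflect {in b &, forall x y, x != y -> x.1 != y.1} (transv b).
Proof.
apply: (iffP forall_inP) => h x => [y xb yb nxy|xb].
  by have /forall_inP/(_ y yb)/implyP := h x xb; apply.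
by apply/forall_inP => y yb; apply/implyP; apply: h.
Qed.

Lemma transvU1 (x : T) (b : {set T}) : transv b -> (forall z, z \in b -> x.1 != z.1) -> transv (x |: b).
Proof.
move=> /transvP tb xb; apply/transvP => y z; rewrite !inE.
case/orP=> [/eqP ->|yb] /orP[/eqP ->|zb] nyz; rewrite ?eqxx // in nyz *.
- exact: xb.
- by rewrite eq_sym xb.
- exact: tb.
Qed.

(** Graphs are encoded as functions on ordered pairs, so an edge has value 1 at both of its
    orientations. *)
Definition edge (x y : T) : V := [ffun p => (p == (x, y))%:R + (p == (y, x))%:R].
Definition rind (G : rel T) : V := [ffun p => (G p.1 p.2)%:R].
Definition crel (b : {set T}) : rel T := fun x y => [&& x != y, x \in b & y \in b].

Definition clique_span (w : V) := exists2 c : {set T} -> int,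
  forall b, ~~ kclique b -> c b = 0 &
  forall p, w p = \sum_b c b * (crel b p.1 p.2)%:R.
Local Notation L := clique_span.

Lemma span0 : L 0.
Proof. by exists (fun=> 0) => // p; rewrite ffunE big1 // => b _; rewrite mul0r. Qed.

Lemma spanD w w' : L w -> L w' -> L (w + w').
Proof.
move=> [c c0 cw] [c' c0' cw']; exists (fun b => c b + c' b) => [b nb|p].
  by rewrite c0 // c0' // addr0.
rewrite ffunE cw cw' -big_split /=; apply: eq_bigr => b _; ring.
Qed.

Lemma spanN w : L w -> L (- w).
Proof.
move=> [c c0 cw]; exists (fun b => - c b) => [b nb|p]; first by rewrite c0 // oppr0.
by rewrite ffunE cw -sumrN; apply: eq_bigr => b _; ring.
Qed.

Lemma spanB w w' : L w -> L w' -> L (w - w').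
Proof. by move=> hw hw'; apply: spanD => //; apply: spanN. Qed.

Lemma spanMn w n : L w -> L (w *+ n).
Proof. by move=> hw; elim: n => [|n IH]; [apply: span0 | rewrite mulrS; apply: spanD]. Qed.

Lemma span_sum (J : finType) (Q : pred J) (f : J -> V) :
  (forall j, Q j -> L (f j)) -> L (\sum_(j | Q j) f j).
Proof. by move=> h; apply: big_ind h => //; [apply: span0 | apply: spanD]. Qed.

Lemma span_clique b : kclique b -> L (rind (crel b)).
Proof.
move=> kb; exists (fun b' => (b' == b)%:R) => [b' nb'|p].
  by case: eqP nb' => // ->; rewrite kb.
rewrite ffunE (bigD1 b) //= eqxx mul1r big1 ?addr0 // => b' /negPf ->.
by rewrite mul0r.
Qed.

Lemma edgeC x y : edge x y = edge y x.
Proof. by apply/ffunP => p; rewrite !ffunE addrC. Qed.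

Lemma sum_pred1_in (S : finType) (C : {set S}) z :
  \sum_(c in C) (z == c)%:R = (z \in C)%:R :> int.
Proof.
case zC: (z \in C).
  rewrite (bigD1 z) //= eqxx big1 ?addr0 // => c /andP[_].
  by rewrite eq_sym => /negPf ->.
by rewrite big1 // => c cC; case: eqP => // e; rewrite e cC in zC.
Qed.

Lemma rind_crelU1 (x : T) (C : {set T}) : x \notin C ->
  rind (crel (x |: C)) = rind (crel C) + \sum_(c in C) edge x c.
Proof.
move=> xC; apply/ffunP => -[y z]; rewrite !ffunE sum_ffunE.
under eq_bigr => c _ do rewrite ffunE !xpair_eqE.
rewrite big_split /=.
have -> : \sum_(c in C) ((y == x) && (z == c))%:R = ((y == x) && (z \in C))%:R :> int.
  case: eqP => _ /=; [exact: sum_pred1_in | by rewrite big1].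
have -> : \sum_(c in C) ((y == c) && (z == x))%:R = ((z == x) && (y \in C))%:R :> int.
  under eq_bigr => c _ do rewrite andbC.
  case: eqP => _ /=; [exact: sum_pred1_in | by rewrite big1].
rewrite /crel !inE.
case: (eqVneq y x) => [->|nyx] /=; case: (eqVneq z x) => [->|nzx] /=;
  rewrite ?(negPf xC) ?eqxx ?andbF ?andbT /= ?addr0 ?add0r //.
by rewrite nyx.
Qed.

Lemma transv_avoiding (S : {set I}) m : (0 < #|A|)%N -> (m + #|S| <= #|I|)%N ->
  exists Z : {set T}, [/\ #|Z| = m, transv Z & forall z, z \in Z -> z.1 \notin S].
Proof.
move=> /card_gt0P[a0 _] hm.
have /card_geqP[r [ur sr rS]] : (m <= #|~: S|)%N by have := cardsC S; lia.
exists [set (i, a0) | i in r]; split.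
- by rewrite card_imset ?(card_uniqP ur) // => i j [].
- apply/transvP => x y /imsetP[i _ ->] /imsetP[j _ ->] /=.
  by apply: contraNneq => ->.
- by move=> z /imsetP[i ir ->]; have := rS _ ir; rewrite inE.
Qed.

Hypothesis A0 : (0 < #|A|)%N.
Hypothesis kI : (k.+2 <= #|I|)%N.
Hypothesis k1 : (1 < k)%N.

(** Take a clique [Z] of [k - 2] points outside the groups involved. In the signed sum of the four
    [k]-cliques formed by [Z], one of [x], [x'] and one of [c], [c'], everything but these four
    edges cancels. Four groups and [k - 2] points explain the bound [k.+2] on the number of
    groups. *)
Lemma span_square (x x' c c' : T) : x.1 != c.1 -> x.1 != c'.1 -> x'.1 != c.1 -> x'.1 != c'.1 ->
  L (edge x c - edge x' c - edge x c' + edge x' c').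
Proof.
move=> xc xc' x'c x'c'.
have cS : (#|[set x.1; x'.1; c.1; c'.1]| <= 4)%N.
  by rewrite !cardsU !cards1; lia.
have [|Z [cZ tZ Zav]] := @transv_avoiding [set x.1; x'.1; c.1; c'.1] (k - 2) A0; first by lia.
have av y z : y \in [:: x; x'; c; c'] -> z \in Z -> y.1 != z.1.
  move=> ys /Zav; rewrite !inE; apply: contra => /eqP <-.
  by move: ys; rewrite !inE => /or4P[]/eqP ->; rewrite eqxx ?orbT.
have nZ y : y \in [:: x; x'; c; c'] -> y \notin Z.
  by move=> ys; apply/negP => yZ; have := av y y ys yZ; rewrite eqxx.
have step y d : y \in [:: x; x'; c; c'] -> d \in [:: x; x'; c; c'] -> y.1 != d.1 ->
    L (rind (crel (d |: Z)) + edge y d + \sum_(z in Z) edge y z).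
  move=> ys ds nyd.
  have ydZ : y \notin d |: Z by rewrite !inE negb_or nZ // andbT; apply: contraNneq nyd => ->.
  have := @rind_crelU1 y (d |: Z) ydZ; rewrite big_setU1 ?nZ //= addrA => <-.
  apply: span_clique; rewrite /kclique !cardsU1 ydZ nZ // cZ; apply/andP; split; first lia.
  apply: transvU1; first by apply: transvU1 => // z zZ; apply: av.
  by move=> z; rewrite !inE => /orP[/eqP -> //|zZ]; apply: av.
have h1 := step x c; have h2 := step x' c; have h3 := step x c'; have h4 := step x' c'.
rewrite !inE !eqxx ?orbT in h1 h2 h3 h4.
have := spanD (spanB (spanB (h1 _ _ _) (h2 _ _ _)) (h3 _ _ _)) (h4 _ _ _).
move/(_ isT isT xc isT isT x'c isT isT xc' isT isT x'c'); congr L.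
by apply/ffunP => p; rewrite !ffunE; ring.
Qed.

(** Modulo [L] every edge [x y] equals [h x + h y + t]. Joining a [(k - 1)]-clique to [x] and to [o]
    shows that [k - 1] kills [h x], and a single [k]-clique then shows that ['C(k, 2)] kills [t].
    The whole graph is the sum of the [h x] weighted by degrees and of [t] weighted by the number of
    edges, which vanishes under the divisibility conditions. *)
Lemma signed_design :
  (forall x : T, k - 1 %| #|[set y : T | x.1 != y.1]|)%N ->
  (k * (k - 1) %| #|[set p : T * T | p.1.1 != p.2.1]|)%N ->
  exists2 c : {set T} -> int, forall b, ~~ kclique b -> c b = 0 &
    forall x y : T, x.1 != y.1 -> \sum_(b : {set T} | (x \in b) && (y \in b)) c b = 1.
Proof.
move=> degE numE.
have pick1 (S : {set I}) : (#|S| < #|I|)%N -> exists x : T, x.1 \notin S.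
  move=> hS; have [|Z [/eqP/cards1P[z ->] _]] := @transv_avoiding S 1 A0; first by lia.
  by move/(_ z (set11 z)); exists z.
have [o _] := pick1 set0 ltac:(by rewrite cards0; lia).
have [o2 no2] := pick1 [set o.1] ltac:(by rewrite cards1; lia).
have [o3 no3] := pick1 [set o.1; o2.1] ltac:(by have := cards2 o.1 o2.1; lia).
have {}no2 : o2.1 != o.1 by move: no2; rewrite !inE.
have {no3}[no3 no32] : o3.1 != o.1 /\ o3.1 != o2.1.
  by move: no3; rewrite !inE negb_or => /andP.
have /fin_all_exists[cc ccP] : forall x : T, exists c : T, (c.1 != x.1) && (c.1 != o.1).
  move=> x; have [|c] := pick1 [set x.1; o.1]; first by have := cards2 x.1 o.1; lia.
  by rewrite !inE negb_or => ?; exists c.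
(* By [span_square] the class of [h x] is the same for every third point [c] in place of [cc x];
   this is [hP]. *)
pose h x := edge x (cc x) - edge o (cc x).
have hP x c : c.1 != x.1 -> c.1 != o.1 -> L (edge x c - edge o c - h x).
  move=> cx co; have /andP[ccx cco] := ccP x.
  have := @span_square x o c (cc x); rewrite !(eq_sym x.1) !(eq_sym o.1).
  move=> /(_ cx ccx co cco); congr L; rewrite /h.
  by apply/ffunP => p; rewrite !ffunE; ring.
(* This value is forced by the edge [o o2], since [h o2] is congruent to [edge o2 o3 - edge o o3]
   and [h o] vanishes. *)
pose t := edge o o2 + edge o o3 - edge o2 o3.
have edgeo y : y.1 != o.1 -> L (edge o y - h y - t).
  move=> yo; have [ey|ny] := eqVneq y.1 o2.1.
    have := spanD (@span_square y o2 o o3 yo _ no2 _) (hP y o3 _ no3).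
    rewrite ey [o2.1 == o3.1]eq_sym no32 => /(_ isT isT isT); congr L.
    rewrite /t [edge y o]edgeC [edge o2 o]edgeC.
    by apply/ffunP => p; rewrite !ffunE; ring.
  have := spanD (@span_square y o3 o o2 yo ny no3 no32) (hP y o2 _ no2).
  rewrite eq_sym ny => /(_ isT); congr L.
  rewrite /t [edge y o]edgeC [edge o3 o]edgeC [edge o3 o2]edgeC.
  by apply/ffunP => p; rewrite !ffunE; ring.
have edgeE x y : x.1 != y.1 -> L (edge x y - h x - h y - t).
  wlog yo : x y / y.1 != o.1 => [hw nxy|nxy].
    have [yo|] := eqVneq y.1 o.1; last by move=> yo; apply: hw.
    have := hw y x; rewrite edgeC -yo => /(_ nxy); rewrite eq_sym => /(_ nxy); congr L.
    by apply/ffunP => p; rewrite !ffunE; ring.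
  have := spanD (hP x y _ yo) (edgeo y yo); rewrite eq_sym => /(_ nxy); congr L.
  by apply/ffunP => p; rewrite !ffunE; ring.
have hk x : L (h x *+ (k - 1)).
  have cS : (#|[set x.1; o.1]| <= 2)%N by rewrite cards2; case: eqP.
  have [|Z [cZ tZ Zav]] := @transv_avoiding [set x.1; o.1] (k - 1) A0; first by lia.
  have av z : z \in Z -> (x.1 != z.1) && (o.1 != z.1).
    by move/Zav; rewrite !inE negb_or ![z.1 == _]eq_sym.
  have cl y : (forall z, z \in Z -> y.1 != z.1) -> L (rind (crel Z) + \sum_(z in Z) edge y z).
    move=> yZ; have nyZ : y \notin Z by apply/negP => /yZ; rewrite eqxx.
    rewrite -rind_crelU1 //; apply: span_clique.
    by rewrite /kclique cardsU1 nyZ cZ transvU1 // andbT; lia.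
  have hx := cl x (fun z zZ => proj1 (andP (av z zZ))).
  have ho := cl o (fun z zZ => proj2 (andP (av z zZ))).
  have hs : L (\sum_(z in Z) (edge x z - edge o z - h x)).
    apply: span_sum => z /av /andP[n1 n2]; apply: hP; by rewrite eq_sym.
  have := spanB (spanB hx ho) hs; congr L.
  rewrite 2!sumrB sumr_const cZ; move: (h x *+ (k - 1)) (\sum_(z in Z) edge x z) => H1 H2.
  move: (\sum_(z in Z) edge o z) => H3.
  by apply/ffunP => p; rewrite !ffunE; ring.
pose lt (x y : T) := (enum_rank x < enum_rank y)%N.
have ltN x y : x != y -> lt y x = ~~ lt x y.
  rewrite /lt -(inj_eq enum_rank_inj) -val_eqE /=; by case: ltngtP.
have ltxx x : lt x x = false by rewrite /lt ltnn.
(* [edgeE] summed over a graph, with [lt] selecting one orientation of each edge. It is applied to a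
   single clique, which yields [tk], and to the whole multipartite graph. *)
have graphE (G : rel T) : symmetric G -> (forall x y, G x y -> x.1 != y.1) ->
   [/\ rind G = \sum_(p : T * T | lt p.1 p.2 && G p.1 p.2) edge p.1 p.2,
     L (rind G - \sum_x h x *+ #|[set y | G x y]|
        - t *+ #|[set p | lt p.1 p.2 && G p.1 p.2]|) &
     #|[set p : T * T | G p.1 p.2]| = (#|[set p | lt p.1 p.2 && G p.1 p.2]| * 2)%N].
  move=> GC GE.
  have nG x y : G x y -> x != y by move=> /GE; apply: contraNneq => ->.
  have eG : rind G = \sum_(p : T * T | lt p.1 p.2 && G p.1 p.2) edge p.1 p.2.
    apply/ffunP => -[x y]; rewrite sum_ffunE ffunE /=.
    under eq_bigr => p _ do rewrite ffunE.
    rewrite big_split /=.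
    have s1 (a : T * T) (Q : pred (T * T)) : \sum_(p | Q p) (a == p)%:R = (Q a)%:R :> int.
      have := sum_pred1_in [set p | Q p] a; rewrite inE => <-.
      by apply: eq_bigl => p; rewrite inE.
    have -> : \sum_(p | lt p.1 p.2 && G p.1 p.2) ((x, y) == (p.1, p.2))%:R
        = (lt x y && G x y)%:R :> int.
      by rewrite -[RHS](s1 (x, y) (fun p => lt p.1 p.2 && G p.1 p.2)); apply: eq_bigr => -[].
    have -> : \sum_(p | lt p.1 p.2 && G p.1 p.2) ((x, y) == (p.2, p.1))%:R
        = (lt y x && G x y)%:R :> int.
      rewrite GC -[RHS](s1 (y, x) (fun p => lt p.1 p.2 && G p.1 p.2)).
      by apply: eq_bigr => -[a b] _; rewrite !xpair_eqE andbC.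
    case Gxy: (G x y); last by rewrite !andbF.
    by rewrite (ltN x y) ?nG // !andbT; case: (lt x y).
  have sG (f : T -> V) : \sum_x f x *+ #|[set y | G x y]| =
      \sum_(p : T * T | lt p.1 p.2 && G p.1 p.2) (f p.1 + f p.2).
    rewrite big_split /=.
    have -> : \sum_(p : T * T | lt p.1 p.2 && G p.1 p.2) f p.2 =
              \sum_(p : T * T | lt p.2 p.1 && G p.1 p.2) f p.1.
      rewrite (reindex_inj (h := fun p : T * T => (p.2, p.1))) /=; last by move=> [? ?] [? ?] [-> ->].
      by apply: eq_bigl => p; rewrite GC.
    have -> : \sum_x f x *+ #|[set y | G x y]| = \sum_(p : T * T | G p.1 p.2) f p.1.
      rewrite [RHS](eq_bigl (fun p => predT p.1 && G p.1 p.2)) //.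
      rewrite -(pair_big_dep predT (fun x y => G x y) (fun x y => f x)) /=.
      by apply: eq_bigr => x _; rewrite sumr_const; congr (_ *+ _); apply: eq_card => y; rewrite !inE.
    rewrite (bigID (fun p => lt p.1 p.2)) /=; congr (_ + _); apply: eq_bigl => p; rewrite 1?andbC //.
    by case Gp: (G p.1 p.2); rewrite ?andbF // (ltN p.1) ?nG.
  split=> //.
    have : L (\sum_(p : T * T | lt p.1 p.2 && G p.1 p.2) (edge p.1 p.2 - h p.1 - h p.2 - t)).
      by apply: span_sum => p /andP[_ /GE]; apply: edgeE.
    congr L; rewrite eG sG 3!sumrB sumr_const [X in _ = _ - X - _]big_split /=.
    have -> : #|[pred p : T * T | lt p.1 p.2 && G p.1 p.2]| = #|[set p : T * T | lt p.1 p.2 && G p.1 p.2]|.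
      by apply: eq_card => p; rewrite !inE.
    by rewrite opprD addrA.
  rewrite muln2 -addnn -[in LHS](cardsID [set p | lt p.1 p.2]); congr (_ + _)%N.
    by apply: eq_card => p; rewrite !inE andbC.
  rewrite -(card_imset _ (f := fun p : T * T => (p.2, p.1))); last by move=> [? ?] [? ?] [-> ->].
  apply: eq_card => -[x y]; rewrite !inE /=; apply/imsetP/andP => [[[a b]]|[lxy Gxy]].
    rewrite !inE /= => /andP[nl Gab] [-> ->]; rewrite GC; split=> //.
    by rewrite (ltN a) ?nG.
  exists (y, x) => //; rewrite !inE /= GC Gxy andbT.
  by rewrite (ltN x) ?nG // lxy.
have tk : L (t *+ 'C(k, 2)).
  have [|Z [cZ tZ _]] := @transv_avoiding set0 k A0; first by rewrite cards0; lia.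
  have [||_ hG cG] := graphE (crel Z).
  - by move=> x y; rewrite /crel eq_sym [(x \in Z) && _]andbC.
  - by move=> x y /and3P[nxy xZ yZ]; apply: (transvP _ tZ).
  have cnt : #|[set p : T * T | crel Z p.1 p.2]| = (k * (k - 1))%N.
    have := cardsX Z Z; rewrite cZ.
    rewrite -(cardsID [set p | p.1 == p.2]).
    have -> : #|setX Z Z :&: [set p | p.1 == p.2]| = k.
      rewrite -[RHS]cZ -(card_imset _ (f := fun x : T => (x, x))); last by move=> ? ? [].
      apply: eq_card => -[x y]; rewrite !inE /=; apply/andP/imsetP => [[/andP[xZ _] /eqP <-]|[z zZ [-> ->]]].
        by exists x.
      by rewrite zZ eqxx.
    have -> : setX Z Z :\: [set p | p.1 == p.2] = [set p : T * T | crel Z p.1 p.2].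
      by apply/setP => p; rewrite !inE.
    by rewrite mulnBr muln1 => <-; rewrite addKn.
  have -> : 'C(k, 2) = #|[set p | lt p.1 p.2 && crel Z p.1 p.2]|.
    by rewrite bin2 -subn1 -cnt cG muln2 doubleK.
  have hs : L (\sum_x h x *+ #|[set y | crel Z x y]|).
    apply: span_sum => x _; case xZ: (x \in Z); last first.
      have -> : [set y | crel Z x y] = set0 by apply/setP => y; rewrite !inE /crel xZ andbF.
      by rewrite cards0; apply: span0.
    have -> : #|[set y | crel Z x y]| = (k - 1)%N; last exact: hk.
      rewrite -cZ (cardsD1 x Z) xZ addKn; apply: eq_card => y.
      by rewrite !inE /crel xZ eq_sym.
  have cl : L (rind (crel Z)) by apply: span_clique; rewrite /kclique cZ eqxx.
  have := spanB (spanB cl hs) hG; congr L; move: (t *+ _) (\sum_x _) => H1 H2.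
  by apply/ffunP => p; rewrite !ffunE; ring.
have [||_ hE cE] := graphE (fun x y => x.1 != y.1) => //.
  by move=> x y; rewrite eq_sym.
have [c c0 cP] : L (rind (fun x y => x.1 != y.1)).
  have hs : L (\sum_x h x *+ #|[set y : T | x.1 != y.1]|).
    apply: span_sum => x _; have /dvdnP[q ->] := degE x.
    by rewrite mulnC mulrnA; apply: spanMn.
  have ht : L (t *+ #|[set p : T * T | lt p.1 p.2 && (p.1.1 != p.2.1)]|).
    have /dvdnP[q e] := numE.
    have ek : (k * (k - 1) = 'C(k, 2) * 2)%N by have := mul_bin_diag k 1; rewrite bin1 -subn1 => ->; rewrite mulnC.
    have -> : #|[set p : T * T | lt p.1 p.2 && (p.1.1 != p.2.1)]| = ('C(k, 2) * q)%N.
      by move: e; rewrite cE ek mulnA => /eqP; rewrite eqn_pmul2r // => /eqP ->; rewrite mulnC.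
    by rewrite mulrnA; apply: spanMn.
  have := spanD (spanD hE hs) ht; congr L; move: (t *+ _) (\sum_x _) => H1 H2.
  by apply/ffunP => p; rewrite !ffunE; ring.
exists c => // x y nxy; have := cP (x, y); rewrite ffunE /= nxy => e; rewrite (_ : 1 = true%:R) // e.
rewrite big_mkcond; apply: eq_bigr => b _; rewrite /crel.
have -> : x != y by apply: contraNneq nxy => ->.
by case: (_ && _); rewrite ?mulr1 ?mulr0.
Qed.

End Signed.

(** * Lifting a multiple covering *)

Section Lift.
Local Open Scope ring_scope.

Lemma poly_interpolation (F : fieldType) (T : eqType) (s : seq T) (r f : T -> F) :
  uniq s -> {in s &, injective r} ->
  exists2 p : {poly F}, (size p <= size s)%N & forall x, x \in s -> p.[r x] = f x.
Proof.
elim: s => [|y s IH] /=; first by exists 0; rewrite ?size_poly0.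
case/andP=> ys us rI.
have [|p sp pP] := IH us; first by move=> a b sa sb; apply: rI; rewrite inE ?sa ?sb orbT.
pose w := \prod_(x <- s) ('X - (r x)%:P).
have w0 x : x \in s -> w.[r x] = 0.
  by move=> xs; rewrite /w (big_rem x xs) /= hornerM hornerXsubC subrr mul0r.
have wy : w.[r y] != 0.
  rewrite /w horner_prod prodf_seq_neq0; apply/allP => x xs /=.
  rewrite hornerXsubC subr_eq0; apply: contraNneq ys => /rI -> //; rewrite ?mem_head //.
  by rewrite inE xs orbT.
exists (p + ((f y - p.[r y]) / w.[r y]) *: w) => [|x].
  rewrite (leq_trans (size_polyD _ _)) // geq_max (leq_trans sp) //=.
  by rewrite (leq_trans (size_scale_leq _ _)) // size_prod_XsubC.
rewrite inE hornerD hornerZ => /orP[/eqP ->|xs].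
  by rewrite divfK // addrC subrK.
by rewrite (w0 x xs) mulr0 addr0 pP.
Qed.

(** The polynomials are chosen one point at a time. The one for a new [z] has a prescribed value at
    each node [rho z x] with [x] in [s], and these nodes are distinct. *)
Lemma chain_interpolation (F : fieldType) (T : eqType) (s : seq T)
    (rho delta : T -> T -> F) :
  uniq s -> (forall x y, rho x y = rho y x) ->
  (forall x, injective (rho x)) ->
  (forall x y, x != y -> delta y x = - delta x y) ->
  exists2 c : T -> {poly F}, (forall x, size (c x) <= size s)%N &
    {in s &, forall x y, x != y -> (c x).[rho x y] - (c y).[rho x y] = delta x y}.
Proof.
move=> + rhoC rhoI dA; elim: s => [|z s IH] /=.
  by exists (fun=> 0) => // x; rewrite size_poly0.
case/andP=> zs /[dup] us /IH[c sc cP].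
have [|p sp pP] := @poly_interpolation F T s (rho z) (fun x => (c x).[rho z x] + delta z x) us.
  by move=> x y _ _; apply: rhoI.
exists (fun x => if x == z then p else c x).
  by move=> x; case: ifP => _; rewrite (leq_trans (_ : _ <= size s)%N).
move=> x y; rewrite !inE.
case: (eqVneq x z) => [->|nx] /=; case: (eqVneq y z) => [->|ny] //=.
- by move=> _ ys nzy; rewrite pP // addrAC subrr add0r.
- by move=> xs _ nxz; rewrite rhoC pP // opprD addrA subrr sub0r (dA _ _ nxz) opprK.
- exact: cP.
Qed.

(* The blocks are [(x, g x * s + c j x + t)] for [x] in [beta j], with [s] and [t]
   polynomials.  As [g x - g y] vanishes at [rho x y], the difference of two points
   over [x] and [y] determines [j] by its value there, and then [s] by division. *)
Lemma decomposable_lift k (T J : finType) (E : rel T) (F : finFieldType)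
    (beta : J -> {set T}) :
  (#|T| <= #|F|)%N ->
  (forall j, #|beta j| = k) ->
  (forall j x y, x != y -> x \in beta j -> y \in beta j -> E x y) ->
  (forall x y, x != y -> E x y -> #|[set j | (x \in beta j) && (y \in beta j)]| = #|F|) ->
  decomposable k (fun x y : T * 'rV[F]_k => (x.1 != y.1) && E x.1 y.1).
Proof.
move=> leTF cb sound lam.
pose alpha (x : T) : F := enum_val (widen_ord leTF (enum_rank x)).
have alphaI : injective alpha.
  move=> x y /enum_val_inj /(congr1 val) /= /val_inj; exact: enum_rank_inj.
(* With [g x = alpha x * X + alpha x ^ 2] below, the difference [g x - g y] is [alpha x - alpha y]
   times [X + alpha x + alpha y], whose root is [rho x y]. *)
pose rho x y := - (alpha x + alpha y).
have rhoC x y : rho x y = rho y x by rewrite /rho addrC.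
have rhoI x : injective (rho x) by move=> y z /oppr_inj /addrI /alphaI.
pose Axy x y := [set j | (x \in beta j) && (y \in beta j)].
(* The blocks through the edge [x y], [#|F|] in number, are labelled bijectively by field elements;
   the default 0 is taken only off [Axy x y]. *)
pose d x y j : F := nth 0 (enum F) (index j (enum (Axy x y))).
have dI x y : x != y -> E x y -> {in Axy x y &, injective (d x y)}.
  move=> nxy Exy i j iA jA; have sz := lam x y nxy Exy; rewrite -/(Axy x y) in sz.
  have hi h : h \in Axy x y -> (index h (enum (Axy x y)) < size (enum F))%N.
    by move=> hA; rewrite -cardE -sz [X in (_ < X)%N]cardE index_mem mem_enum.
  move/eqP; rewrite nth_uniq ?hi ?enum_uniq // => /eqP e.
  by rewrite -(nth_index i (s := enum (Axy x y)) (x := i)) ?mem_enum // e nth_index ?mem_enum.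
have dS x y (z : F) : x != y -> E x y -> exists2 j, j \in Axy x y & d x y j = z.
  move=> nxy Exy; have sz := lam x y nxy Exy; rewrite -/(Axy x y) in sz.
  have : z \in [set d x y j | j in Axy x y].
    suff -> : [set d x y j | j in Axy x y] = setT by rewrite inE.
    apply/eqP; rewrite eqEcard subsetT /= cardsT card_in_imset ?sz //; exact: dI.
  by case/imsetP=> j jA ->; exists j.
pose lt (x y : T) := (enum_rank x < enum_rank y)%N.
pose delta j x y := if lt x y then d x y j else - d y x j.
have dA j x y : x != y -> delta j y x = - delta j x y.
  rewrite /delta /lt -(inj_eq enum_rank_inj) -val_eqE /=.
  by case: ltngtP => //; rewrite ?opprK.
have AC x y : Axy x y = Axy y x by apply/setP => j; rewrite !inE andbC.
have deltaI x y : x != y -> E x y -> E y x -> {in Axy x y &, injective (fun j => delta j x y)}.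
  move=> nxy Exy Eyx i j; rewrite /delta; case: ifP => _; first exact: dI.
  by rewrite AC => iA jA /oppr_inj; apply: dI; rewrite // eq_sym.
have deltaS x y (z : F) : x != y -> E x y -> E y x ->
    exists2 j, j \in Axy x y & delta j x y = z.
  move=> nxy Exy Eyx; case l: (lt x y).
    by have [j jA dj] := dS x y z nxy Exy; exists j; rewrite // /delta l.
  have nyx : y != x by rewrite eq_sym.
  have [j jA dj] := dS y x (- z) nyx Eyx.
  by exists j; [rewrite AC|rewrite /delta l dj opprK].
have EC x y : x != y -> E x y -> E y x.
  move=> nxy Exy; have [j] := dS x y 0 nxy Exy; rewrite inE => /andP[xj yj] _.
  by apply: (sound j); rewrite // eq_sym.
have /fin_all_exists[c cP] : forall j, exists c : T -> {poly F},
    (forall x, size (c x) <= k)%N /\ {in beta j &, forall x y, x != y ->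
      (c x).[rho x y] - (c y).[rho x y] = delta j x y}.
  move=> j; have [c sc cP] := @chain_interpolation F T (enum (beta j)) rho (delta j)
     (enum_uniq _) rhoC rhoI (dA j).
  exists c; split=> [x|x y xj yj]; first by rewrite -[X in (_ <= X)%N](cb j) cardE.
  by apply: cP; rewrite mem_enum.
pose g x : {poly F} := (alpha x)%:P * ('X + (alpha x)%:P).
have gB x y : g x - g y = (alpha x - alpha y)%:P * ('X - (rho x y)%:P).
  by rewrite /g /rho polyCN polyCB polyCD; ring.
have sg x : (size (g x) <= 2)%N.
  rewrite /g mul_polyC (leq_trans (size_scale_leq _ _)) //.
  by rewrite size_XaddC.
(* [s] has [k.-1] coefficients and [g x] has degree at most 1, so the result again has at most [k]
   coefficients. *)
pose pt (j : J) (s : 'rV[F]_k.-1) x : {poly F} := g x * rVpoly s + c j x.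
have spt j s x : x \in beta j -> (size (pt j s x) <= k)%N.
  move=> xj; have k0 : (0 < k)%N by rewrite -(cb j); apply/card_gt0P; exists x.
  rewrite (leq_trans (size_polyD _ _)) // geq_max (proj1 (cP j)) andbT.
  rewrite (leq_trans (size_polyMleq _ _)) //.
  have := sg x; have : (size (rVpoly s) <= k.-1)%N by apply: size_poly.
  by move: (size (g x)) (size (rVpoly s)) => m n; lia.
pose bl (h : J * 'rV[F]_k.-1 * 'rV[F]_k) :=
  [set (x, poly_rV (pt h.1.1 h.1.2 x) + h.2) | x in beta h.1.1].
have inbl h x a : ((x, a) \in bl h) =
    (x \in beta h.1.1) && (a == poly_rV (pt h.1.1 h.1.2 x) + h.2).
  by apply/imsetP/andP => [[y yb [-> ->]]|[xb /eqP ->]] //; exists x.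
have ptB j s x y : x \in beta j -> y \in beta j ->
    pt j s x - pt j s y = (alpha x - alpha y)%:P * ('X - (rho x y)%:P) * rVpoly s
       + (c j x - c j y).
  by move=> _ _; rewrite -gB /pt; ring.
have ptR j s x y : x != y -> x \in beta j -> y \in beta j ->
    (pt j s x - pt j s y).[rho x y] = delta j x y.
  move=> nxy xj yj; rewrite ptB // hornerD !hornerM hornerXsubC subrr mulr0 mul0r add0r.
  by rewrite hornerD hornerN (proj2 (cP j)).
apply: (@decomposable_family _ _ _ bl).
- by move=> h; rewrite card_imset // => x y [].
- move=> h [x a] [y b] nxy; rewrite !inbl /= => /andP[xh /eqP ea] /andP[yh /eqP eb].
  have nx : x != y by apply: contraNneq nxy => e; rewrite ea eb e.
  by rewrite nx (sound h.1.1).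
- move=> [x a] [y b] _ /= /andP[nx Exy].
  have [j] := deltaS x y (rVpoly (a - b)).[rho x y] nx Exy (EC x y nx Exy).
  rewrite inE => /andP[xj yj] dj.
  pose w := rVpoly (a - b) - (c j x - c j y).
  have k0 : (0 < k)%N by rewrite -(cb j); apply/card_gt0P; exists x.
  have sw : (size w <= k)%N.
    rewrite (leq_trans (size_polyD _ _)) // geq_max size_poly size_polyN /=.
    by rewrite (leq_trans (size_polyD _ _)) // geq_max size_polyN !(proj1 (cP j)).
  (* The choice of [j] makes [w] vanish at [rho x y], so it is a multiple of [X - rho x y], and the
     quotient, divided by [alpha x - alpha y], is the required [s]. *)
  have : root w (rho x y).
    by rewrite /root /w !hornerE (proj2 (cP j)) // dj subrr.
  case/factor_theorem=> w1 ew.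
  have sw1 : (size w1 <= k.-1)%N.
    have [->|w10] := eqVneq w1 0; first by rewrite size_poly0.
    by move: sw; rewrite ew size_Mmonic ?monicXsubC // size_XsubC addn2 /= -[X in (_ < X)%N](prednK k0).
  pose s : 'rV[F]_k.-1 := poly_rV ((alpha x - alpha y)^-1 *: w1).
  have es : rVpoly s = (alpha x - alpha y)^-1 *: w1.
    by rewrite poly_rV_K // (leq_trans (size_scale_leq _ _)).
  have ax : alpha x - alpha y != 0 by rewrite subr_eq0 (inj_eq alphaI).
  have e : pt j s x - pt j s y = rVpoly (a - b).
    rewrite ptB // es -mul_polyC mulrACA -polyCM mulfV // mul1r mulrC -ew /w subrK //.
  exists (j, s, a - poly_rV (pt j s x)); rewrite !inbl /= xj yj addrC subrK eqxx.
  split=> //=; apply/eqP.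
  have := congr1 (@poly_rV _ k) e; rewrite rVpolyK linearB /= => e'.
  by rewrite -[LHS](subKr a) -e' opprB addrCA.
move=> [[j s] t] [[j' s'] t'] [x a] [y b] nxy; rewrite !inbl /=.
move=> /andP[xj /eqP e1] /andP[yj /eqP e2] /andP[xj' /eqP e1'] /andP[yj' /eqP e2'].
have nx : x != y by apply: contraNneq nxy => e; rewrite e1 e2 e.
have ab : rVpoly (a - b) = pt j s x - pt j s y.
  rewrite e1 e2 opprD addrACA subrr addr0 -linearB /= poly_rV_K //.
  by rewrite (leq_trans (size_polyD _ _)) // geq_max size_polyN !spt.
have ab' : rVpoly (a - b) = pt j' s' x - pt j' s' y.
  rewrite e1' e2' opprD addrACA subrr addr0 -linearB /= poly_rV_K //.
  by rewrite (leq_trans (size_polyD _ _)) // geq_max size_polyN !spt.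
have Exy : E x y by apply: (sound j).
have ej : j = j'.
  apply: (deltaI x y nx Exy (EC _ _ nx Exy)); rewrite ?inE ?xj ?yj ?xj' ?yj' //.
  have := congr1 (horner^~ (rho x y)) ab; have := congr1 (horner^~ (rho x y)) ab'.
  by rewrite /= !ptR // => -> ->.
rewrite -ej in e1' ab' *; rewrite ab !ptB // in ab'.
have /mulfI : (alpha x - alpha y)%:P * ('X - (rho x y)%:P) != 0.
  by rewrite mulf_neq0 ?polyXsubC_eq0 // polyC_eq0 subr_eq0 (inj_eq alphaI).
move/(_ _ _ (addIr _ ab')) => /(can_inj (@rVpolyK _ _)) es.
by move: e1'; rewrite -es e1 => /addrI ->.
Qed.

End Lift.

(** A permutation of the groups combined with permutations inside the groups carries [x] to [x'] and
    [y] to [y'] and preserves [k]-cliques. Used in both directions, it shows that all edges lie in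
    equally many [k]-cliques. *)
Lemma kclique_count_le k (I A : finType) (x y x' y' : I * A) :
  x.1 != y.1 -> x'.1 != y'.1 ->
  #|[set b | kclique k b & (x \in b) && (y \in b)]| <=
  #|[set b | kclique k b & (x' \in b) && (y' \in b)]|.
Proof.
move=> nxy nxy'.
pose pi : I -> I := tperm (tperm x.1 x'.1 y.1) y'.1 \o tperm x.1 x'.1.
have piI : injective pi by apply: inj_comp; apply: perm_inj.
have pix : pi x.1 = x'.1.
  rewrite /pi /= tpermL tpermD //; last by rewrite eq_sym.
  by rewrite -[X in _ != X](tpermL x.1) (inj_eq perm_inj) eq_sym.
have piy : pi y.1 = y'.1 by rewrite /pi /= tpermL.
pose sg (p : I * A) : I * A := (pi p.1,
  if p.1 == x.1 then tperm x.2 x'.2 p.2 else tperm y.2 y'.2 p.2).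
have sgI : injective sg.
  by move=> [i a] [j b] [/piI <-] /=; case: ifP => _ /perm_inj ->.
have sgx : sg x = x' by rewrite /sg eqxx tpermL pix -surjective_pairing.
have sgy : sg y = y' by rewrite /sg eq_sym (negPf nxy) tpermL piy -surjective_pairing.
rewrite -(card_imset _ (imset_inj sgI)); apply: subset_leq_card.
apply/subsetP => b' /imsetP[b]; rewrite inE => /and3P[kb xb yb] ->.
rewrite inE -{1}sgx -{1}sgy !imset_f //= ?andbT; case/andP: kb => cb /transvP tb.
rewrite /kclique card_imset // cb /=; apply/transvP => p q /imsetP[p0 p0b ->] /imsetP[q0 q0b ->] npq.
by rewrite /= (inj_eq piI); apply: tb => //; apply: contraNneq npq => ->.
Qed.

Lemma card_multipartite u g (x : 'I_u * 'I_g) :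
  #|[set y : 'I_u * 'I_g | x.1 != y.1]| = g * (u - 1).
Proof.
have -> : [set y : 'I_u * 'I_g | x.1 != y.1] = setX (~: [set x.1]) setT.
  by apply/setP => y; rewrite !inE andbT eq_sym.
by rewrite cardsX cardsCs setCK cards1 cardsT !card_ord mulnC.
Qed.

Lemma card_pairs_sum (S S' : finType) (Q : S -> S' -> bool) :
  #|[set p : S * S' | Q p.1 p.2]| = \sum_x #|[set y | Q x y]|.
Proof.
rewrite -sum1_card (eq_bigl (fun p : S * S' => predT p.1 && Q p.1 p.2)); last by move=> p; rewrite inE.
rewrite -(pair_big_dep predT (fun x y => Q x y) (fun x y => 1)) /=.
by apply: eq_bigr => x _; rewrite -sum1_card; apply: eq_bigl => y; rewrite inE.
Qed.

(** If every edge lies in [mu] cliques, adding [s] to all coefficients of a signed solution covers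
    each edge [1 + s * mu = #|F|] times. For large [s] the coefficients are nonnegative
    multiplicities, and [decomposable_lift] turns this covering into a design. *)
Lemma GD_field k u g : 1 < k -> k.+2 <= u -> 0 < g ->
  k - 1 %| g * (u - 1) -> k * (k - 1) %| g * u * (g * (u - 1)) ->
  exists mu Q0, 0 < mu /\ forall F : finFieldType,
    mu %| #|F| - 1 -> Q0 <= #|F| -> GD k u (g * #|F| ^ k).
Proof.
move=> k1 ku g0 degd numd.
pose T : finType := ('I_u * 'I_g)%type.
have [|||||c c0 cP] := @signed_design k 'I_u 'I_g.
- by rewrite card_ord.
- by rewrite card_ord.
- by [].
- by move=> x; rewrite card_multipartite.
- have -> // : #|[set p : T * T | p.1.1 != p.2.1]| = g * u * (g * (u - 1)).
  rewrite (card_pairs_sum (fun x y : T => x.1 != y.1)).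
  under eq_bigr => x _ do rewrite card_multipartite.
  by rewrite sum_nat_const card_prod !card_ord [u * g]mulnC.
have [Z [cZ tZ _]] : exists Z : {set T}, [/\ #|Z| = k, transv Z & forall z, z \in Z -> z.1 \notin set0].
  by apply: transv_avoiding; rewrite ?cards0 card_ord //; lia.
have [x0 [y0 [xZ yZ n0]]] : exists x y, [/\ x \in Z, y \in Z & x != y].
  have /card_gt1P[x [y [xZ yZ nxy]]] : 1 < #|Z| by rewrite cZ.
  by exists x, y.
have n0' : x0.1 != y0.1 by apply: (transvP _ tZ).
pose mu := #|[set b | kclique k b & (x0 \in b) && (y0 \in b)]|.
have muE (x y : T) : x.1 != y.1 -> #|[set b | kclique k b & (x \in b) && (y \in b)]| = mu.
  by move=> nxy; apply/eqP; rewrite eqn_leq !kclique_count_le.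
have mu0 : 0 < mu.
  by apply/card_gt0P; exists Z; rewrite inE /kclique cZ eqxx tZ xZ yZ.
pose M := \sum_b `|c b|%N.
(* The term [u * g] lets the points inject into [F], and [M * mu] forces [s] to be at least every
   [|c b|]. *)
exists mu, (u * g + M * mu + 1); split=> // F muF bigF.
have [s qs] : exists s, #|F| = 1 + s * mu by case/dvdnP: muF => s e; exists s; lia.
have sM : M <= s by rewrite -(leq_pmul2r mu0); lia.
have cM b : (0 <= c b + s%:Z)%R.
  have : `|c b|%N <= M by rewrite /M (bigD1 b) //= leq_addr.
  by lia.
pose m b := `|(c b + s%:Z)%R|%N.
pose N := \sum_(b : {set T}) m b.
have mN b : m b <= N by rewrite /N (bigD1 b) //= leq_addr.
(* Each clique [b] is listed with [m b] copies, numbered inside the common bound [N]. *)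
pose J : finType := {p : {set T} * 'I_N | kclique k p.1 && (p.2 < m p.1)}.
pose beta (j : J) := (val j).1.
have dec : decomposable k (fun x y : T * 'rV[F]_k => (x.1 != y.1) && (x.1.1 != y.1.1)).
  apply: (@decomposable_lift k T J (fun x y => x.1 != y.1) F beta).
  - by rewrite card_prod !card_ord; lia.
  - by move=> j; have /andP[/andP[/eqP]] := valP j.
  - by move=> j x y nxy xj yj; have /andP[/andP[_ /transvP tj] _] := valP j; apply: tj.
  - move=> x y _ nxy.
    have -> : #|[set j | (x \in beta j) && (y \in beta j)]| =
        #|[set p : {set T} * 'I_N | [&& kclique k p.1, (x \in p.1) && (y \in p.1) & p.2 < m p.1]]|.
      rewrite -(card_imset _ val_inj); apply: eq_card => p; rewrite inE.
      apply/imsetP/and3P => [[j]|[kp xyp lp]].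
        by rewrite inE => xyj ->; have /andP[kj lj] := valP j; split.
      have hp : kclique k p.1 && (p.2 < m p.1) by rewrite kp.
      by exists (exist _ p hp); rewrite ?inE.
    rewrite (card_pairs_sum (fun b (i : 'I_N) => [&& kclique k b, (x \in b) && (y \in b) & i < m b])).
    have cnt b : #|[set i : 'I_N | [&& kclique k b, (x \in b) && (y \in b) & i < m b]]| =
        if kclique k b && ((x \in b) && (y \in b)) then m b else 0.
      case: (kclique k b) => /=; last by apply: eq_card0 => i; rewrite !inE.
      case: (_ && _) => /=; last by apply: eq_card0 => i; rewrite !inE.
      rewrite -[RHS](card_ord (m b)) -[RHS](card_imset _ (f := widen_ord (mN b))).
        apply: eq_card => i; rewrite inE; apply/idP/imsetP => [li|[i' _ ->]]; last exact: (ltn_ord i').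
        by exists (Ordinal li) => //; apply: val_inj.
      by move=> i i' /(congr1 val) /= /val_inj.
    under eq_bigr => b _ do rewrite cnt.
    rewrite -big_mkcond /=.
    suff : ((\sum_(b : {set T} | kclique k b && ((x \in b) && (y \in b))) m b)%:Z = #|F|%:Z)%R by move=> [].
    rewrite -natz natr_sum.
    under eq_bigr => b _ do rewrite natz /m gez0_abs //.
    rewrite big_split /= sumr_const.
    have -> : (\sum_(b : {set T} | kclique k b && ((x \in b) && (y \in b))) c b = 1)%R.
      rewrite -[RHS](cP x y nxy) big_mkcond [RHS]big_mkcond /=; apply: eq_bigr => b _.
      by case kb: (kclique k b) => //=; rewrite c0 ?kb // if_same.
    have -> : #|[pred b : {set T} | kclique k b && ((x \in b) && (y \in b))]| = mu.
      by rewrite -(muE x y nxy); apply: eq_card => b; rewrite !inE.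
    by rewrite qs -mulr_natr natz -PoszM PoszD.
apply: (@decomposable_GD _ _ _ 'I_u ('I_g * 'rV[F]_k)%type); rewrite ?card_prod ?card_mx ?card_ord ?mul1n //.
pose f (x : T * 'rV[F]_k) := (x.1.1, (x.1.2, x.2)).
apply: (@decomposable_bij _ _ _ f) dec.
  by exists (fun x => ((x.1, x.2.1), x.2.2)); [move=> [[]]|move=> [? []]].
move=> [[i a] b] [[i' a'] b'] _ /=; case: (eqVneq i i') => [|ni]; first by rewrite andbF.
by rewrite andbT; apply/esym; apply: contra ni => /eqP[->].
Qed.

(** * Cyclotomic difference families *)

Section Cyclotomy.
Local Open Scope ring_scope.

Variables (F : finFieldType) (e f : nat).
Hypothesis e0 : (0 < e)%N.
Hypothesis f0 : (0 < f)%N.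
Hypothesis cF : #|F| = (e * f).+1.

(* The fibres of [x |-> x ^+ f] on nonzero elements are the cosets of the [e]-th powers,
   so a coset is encoded by its value. *)
Definition cyc_classes : {set F} := [set x ^+ f | x in [set~ 0]].
Local Notation X := cyc_classes.

Lemma card_unity_le (n : nat) (v : F) : (0 < n)%N -> (#|[set x | x ^+ n == v]| <= n)%N.
Proof.
move=> n0; rewrite cardE.
have p0 : 'X^n - v%:P != 0 :> {poly F} by rewrite -size_poly_eq0 size_XnsubC.
rewrite -ltnS -(size_XnsubC v n0); apply: max_poly_roots p0 _ (enum_uniq _).
by apply/allP => x; rewrite mem_enum inE /root !hornerE subr_eq0.
Qed.

Lemma expf_card_pred (x : F) : x != 0 -> x ^+ (e * f) = 1.
Proof.
by move=> x0; apply: (mulIf x0); rewrite -exprSr -cF mul1r expf_card.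
Qed.

Lemma cyc_classes_neq0 v : v \in X -> v != 0.
Proof. by case/imsetP=> x; rewrite !inE => x0 ->; rewrite expf_neq0. Qed.

Lemma mem_cyc_classes (x : F) : x != 0 -> x ^+ f \in X.
Proof. by move=> x0; apply: imset_f; rewrite !inE. Qed.

(** The set [X] consists of roots of [x ^+ e = 1] and each fibre has at most [f] points, while the
    fibres contain [e * f] points in total; so both bounds are attained. *)
Lemma card_cyc : #|X| = e /\ (forall v, v \in X -> #|[set x : F | x ^+ f == v]| = f).
Proof.
have Xe : (#|X| <= e)%N.
  apply: leq_trans (card_unity_le 1 e0); apply: subset_leq_card; apply/subsetP => v.
  case/imsetP=> x; rewrite !inE => x0 ->.
  by rewrite -exprM mulnC expf_card_pred.
have tot : (\sum_(v in X) #|[set x : F | x ^+ f == v]| = e * f)%N.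
  have := cardsC1 (0 : F); rewrite cF /= => <-.
  rewrite -sum1_card [RHS](partition_big (fun x : F => x ^+ f) (mem X)) /=; last first.
    by move=> x; rewrite !inE; apply: mem_cyc_classes.
  apply: eq_bigr => v vX; rewrite -sum1_card; apply: eq_bigl => x; rewrite !inE.
  case: (eqVneq (x ^+ f) v) => [exv|]; rewrite ?andbF ?andbT //; apply/esym.
  by apply: contra_neq (cyc_classes_neq0 vX) => x0; rewrite -exv x0 expr0n eqn0Ngt f0.
have Xe' : #|X| = e.
  apply/eqP; rewrite eqn_leq Xe /=; rewrite -(leq_pmul2r f0) -tot -sum_nat_const.
  by apply: leq_sum => v _; apply: card_unity_le.
split=> // v vX; apply/eqP; rewrite eqn_leq card_unity_le //=.
move: tot; rewrite -{1}Xe' (bigD1 v) //= (cardsD1 v X) vX mulnDl mul1n => tot.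
have : (\sum_(w in X | w != v) #|[set x : F | x ^+ f == w]| <= #|X :\ v| * f)%N.
  rewrite -sum_nat_const; apply: (@leq_trans (\sum_(w in X | w != v) f)).
    by apply: leq_sum => w _; apply: card_unity_le.
  by apply/eq_leq/eq_bigl => w; rewrite !inE andbC.
by move=> h; rewrite -(leq_add2r (#|X :\ v| * f)) -tot leq_add2l.
Qed.

(** The candidates in [S] joined to [x] by colour [v], when the pair [x], [a] is coloured by
    [(a - x) ^+ f]. *)
Definition cyc_nbrs (S : {set F}) v x := [set a in S | (a - x) ^+ f == v].

Lemma sum_cyc_nbrs S v : v \in X -> (\sum_x #|cyc_nbrs S v x| = #|S| * f)%N.
Proof.
move=> vX; rewrite -(card_pairs_sum (fun x a => (a \in S) && ((a - x) ^+ f == v))).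
rewrite -(card_imset _ (f := fun p : F * F => (p.2, p.2 - p.1))); last first.
  by move=> [a b] [c d] [/= -> /addrI /oppr_inj ->].
have -> : [set (p.2, p.2 - p.1) | p in [set p : F * F | (p.2 \in S) && ((p.2 - p.1) ^+ f == v)]]
   = setX S [set y | y ^+ f == v].
  apply/setP => -[a y]; rewrite !inE /=; apply/imsetP/andP => [[p]|[aS ya]].
    by rewrite inE => /andP[pS py] [-> ->].
  by exists (a - y, a); rewrite ?inE /= ?subKr ?aS.
by rewrite cardsX (proj2 card_cyc).
Qed.

(** The second moment counts triples [x], [a], [b] where [a] and [b] have the same colour at [x].
    For [a = b] there are at most [#|F|] choices of [x]; for [a != b] the quotient
    [(a - x) / (b - x)] is an [f]-th root of unity that determines [x], leaving at most [f]. *)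
Lemma sum_sq_cyc_nbrs S : (\sum_x \sum_(v in X) #|cyc_nbrs S v x| ^ 2 <= #|S| * #|F| + #|S| ^ 2 * f)%N.
Proof.
pose Q x (p : F * F) := [&& p.1 \in S, p.2 \in S, p.1 != x & (p.1 - x) ^+ f == (p.2 - x) ^+ f].
apply: (@leq_trans (\sum_x #|[set p | Q x p]|)).
  apply: leq_sum => x _.
  have -> : (\sum_(v in X) #|cyc_nbrs S v x| ^ 2 = \sum_(v in X) #|setX (cyc_nbrs S v x) (cyc_nbrs S v x)|)%N.
    by apply: eq_bigr => v _; rewrite cardsX mulnn.
  rewrite -[X in (_ <= X)%N]sum1_card.
  rewrite (partition_big (fun p : F * F => (p.1 - x) ^+ f) (mem X)) /=; last first.
    by move=> p; rewrite inE => /and4P[_ _ px _]; apply: mem_cyc_classes; rewrite subr_eq0.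
  apply: leq_sum => v vX; rewrite -sum1_card; apply/eq_leq/eq_bigl => -[a b].
  rewrite !inE /Q /=; case: (a \in S); case: (b \in S); rewrite /= ?andbF //=.
  case: (eqVneq ((a - x) ^+ f) v) => [eav|_] /=; last by rewrite andbF.
  rewrite andbT eav eq_sym; case: (v == _); rewrite ?andbF // andbT; apply/esym.
  apply/eqP => ax; move: (cyc_classes_neq0 vX); rewrite -eav ax subrr expr0n.
  by rewrite eqn0Ngt f0 eqxx.
rewrite -(card_pairs_sum Q).
rewrite -(card_imset _ (f := fun h : F * (F * F) => (h.2, h.1))); last by move=> [? ?] [? ?] [-> ->].
have -> : [set (p.2, p.1) | p in [set p : F * (F * F) | Q p.1 p.2]] = [set p : (F * F) * F | Q p.2 p.1].
  apply/setP => -[p x]; rewrite !inE; apply/imsetP/idP => [[h]|hq]; first by rewrite inE => ? [-> ->].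
  by exists (x, p); rewrite ?inE.
rewrite (card_pairs_sum (fun p x => Q x p)).
have bound p : (#|[set x | Q x p]| <= ((p.1 \in S) && (p.2 \in S)) * ((p.1 == p.2) * #|F| + f))%N.
  case: p => a b /=; rewrite /Q /=.
  case aS: (a \in S) => /=; last by rewrite leqn0 cards_eq0; apply/eqP/setP => x; rewrite !inE.
  case bS: (b \in S) => /=; last by rewrite leqn0 cards_eq0; apply/eqP/setP => x; rewrite !inE.
  rewrite mul1n; case: (eqVneq a b) => [_|nab]; first by rewrite mul1n (leq_trans (max_card _)) // leq_addr.
  rewrite mul0n add0n; apply: leq_trans (card_unity_le 1 f0).
  have bx x : (a != x) && ((a - x) ^+ f == (b - x) ^+ f) -> b - x != 0.
    case/andP=> ax /eqP eab; apply/eqP => b0; move: eab; rewrite b0 expr0n eqn0Ngt f0 /=.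
    by move/eqP; rewrite expf_eq0 f0 subr_eq0 (negPf ax).
  rewrite -(card_in_imset (f := fun x => (a - x) / (b - x))).
    apply: subset_leq_card; apply/subsetP => y /imsetP[x]; rewrite !inE => hx ->.
    by case/andP: (hx) => _ /eqP eab; rewrite expr_div_n eab divff // expf_neq0 // bx.
  move=> x y; rewrite !inE => /bx bx0 /bx by0.
  (* In this form the quotient is visibly injective in [z]. *)
  have sp z : b - z != 0 -> (a - z) / (b - z) = 1 + (a - b) / (b - z).
    by move=> bz; rewrite (_ : a - z = (b - z) + (a - b)); [rewrite mulrDl divff | ring].
  rewrite !sp // => /addrI /mulfI; rewrite subr_eq0 => /(_ nab) /invr_inj /addrI.
  exact: oppr_inj.
apply: leq_trans (leq_sum _ (fun p _ => bound p)) _.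
rewrite (eq_bigr (fun p : F * F => ((p.1 \in S) && (p.2 \in S) && (p.1 == p.2)) * #|F| +
    ((p.1 \in S) && (p.2 \in S)) * f)%N); last first.
  by move=> p _; rewrite mulnDr mulnA mulnb.
rewrite big_split /= -!big_distrl /=.
have -> : (\sum_(p : F * F) ((p.1 \in S) && (p.2 \in S)) = #|S| ^ 2)%N.
  rewrite -mulnn -cardsX -sum1_card [RHS]big_mkcond /=; apply: eq_bigr => p _.
  by rewrite inE; case: (_ && _).
have -> // : (\sum_(p : F * F) ((p.1 \in S) && (p.2 \in S) && (p.1 == p.2)) = #|S|)%N.
rewrite -(card_imset _ (f := fun x : F => (x, x))); last by move=> ? ? [].
rewrite -sum1_card [RHS]big_mkcond /=; apply: eq_bigr => -[a b] _ /=.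
case: imsetP => [[x xS [-> ->]]|nS]; first by rewrite xS eqxx.
case: eqP => [eab|]; rewrite ?andbF // andbT; case aS: (a \in S) => //=.
by case: nS; exists a; [rewrite aS | rewrite eab].
Qed.

(** Chebyshev's inequality: the squares of [e * #|cyc_nbrs S v x| - #|S|] sum to at most
    [e ^ 2 * n * q + e * n ^ 2], and every exceptional [x] contributes at least a quarter of
    [n ^ 2]. *)
Lemma card_cyc_bad (S : {set F}) D : (#|F| <= D * #|S|)%N ->
  (#|[set x | [exists v in X, 2 * e * #|cyc_nbrs S v x| < #|S|]]| <= 8 * e ^ 2 * D)%N.
Proof.
move=> FD; set Bd := [set x | _].
set n := #|S| in FD *; set q := #|F| in FD *.
have q0 : (0 < q)%N by rewrite /q cF.
have n0 : (0 < n)%N by case: n FD => //; rewrite muln0 leqNgt q0.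
have nq : (n <= q)%N by apply: max_card.
have sq2 : (\sum_x \sum_(v in X) (e%:Z * #|cyc_nbrs S v x|%:Z - n%:Z) ^+ 2 <= e%:Z ^+ 2 * n%:Z * q%:Z + e%:Z * n%:Z ^+ 2)%R.
  have -> : \sum_x \sum_(v in X) (e%:Z * #|cyc_nbrs S v x|%:Z - n%:Z) ^+ 2 =
     e%:Z ^+ 2 * (\sum_x \sum_(v in X) #|cyc_nbrs S v x| ^ 2)%N%:Z
     - 2 * e%:Z * n%:Z * (\sum_x \sum_(v in X) #|cyc_nbrs S v x|)%N%:Z + q%:Z * e%:Z * n%:Z ^+ 2.
    have -> : q%:Z * e%:Z * n%:Z ^+ 2 = \sum_(x : F) \sum_(v in X) n%:Z ^+ 2.
      by rewrite !sumr_const (proj1 card_cyc) -mulrnA -mulr_natl natz PoszM; ring.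
    rewrite -!natz !natr_sum !mulr_sumr -sumrB -big_split /=; apply: eq_bigr => x _.
    rewrite !natr_sum !mulr_sumr -sumrB -big_split /=; apply: eq_bigr => v _.
    by rewrite natrX; ring.
  have s1 : (\sum_x \sum_(v in X) #|cyc_nbrs S v x| = e * (n * f))%N.
    rewrite exchange_big /= (eq_bigr (fun=> n * f)%N); last by move=> v vX; rewrite sum_cyc_nbrs.
    by rewrite sum_nat_const (proj1 card_cyc).
  have s2 := sum_sq_cyc_nbrs S; rewrite s1.
  move: s2; set W := (\sum_x _)%N; rewrite -/n -/q => s2.
  have s2z : W%:Z <= n%:Z * q%:Z + n%:Z ^+ 2 * f%:Z by rewrite expr2 -!PoszM -PoszD lez_nat mulnn.
  have qz : q%:Z = e%:Z * f%:Z + 1 by rewrite /q cF -addn1 PoszD PoszM.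
  have : e%:Z ^+ 2 * W%:Z <= e%:Z ^+ 2 * (n%:Z * q%:Z + n%:Z ^+ 2 * f%:Z).
    by apply: Num.Theory.ler_wpM2l => //; apply: Num.Theory.exprn_ge0.
  rewrite !PoszM qz; nia.
have low : (#|Bd|%:Z * n%:Z ^+ 2 <= 4 * \sum_x \sum_(v in X) (e%:Z * #|cyc_nbrs S v x|%:Z - n%:Z) ^+ 2)%R.
  rewrite mulr_sumr (bigID (mem Bd)) /= -[X in X <= _]addr0; apply: Num.Theory.lerD; last first.
    by apply: Num.Theory.sumr_ge0 => x _; rewrite Num.Theory.mulr_ge0 // Num.Theory.sumr_ge0 // => v _; apply: Num.Theory.sqr_ge0.
  rewrite mulrC -[#|Bd|%:Z]natz mulr_natr -sumr_const; apply: Num.Theory.ler_sum => x.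
  rewrite inE => /exists_inP[v vX lv]; rewrite (bigD1 v) //= mulrDr.
  apply: (@Order.POrderTheory.le_trans _ _ (4 * (e%:Z * #|cyc_nbrs S v x|%:Z - n%:Z) ^+ 2)).
    rewrite -/n in lv; move: (#|cyc_nbrs S v x|) lv => N lv.
    have : 2 * (e%:Z * N%:Z) <= n%:Z by lia.
    have : 0 <= e%:Z * N%:Z by lia.
    move: (e%:Z * N%:Z) => y y0 y2.
    rewrite (_ : 4 * (y - n%:Z) ^+ 2 = (2 * (n%:Z - y)) ^+ 2); last by ring.
    by rewrite !expr2; apply: Num.Theory.ler_pM => //; lia.
  rewrite Num.Theory.lerDl Num.Theory.mulr_ge0 // Num.Theory.sumr_ge0 // => w _; exact: Num.Theory.sqr_ge0.
have main : (#|Bd| * n ^ 2 <= 8 * e ^ 2 * D * n ^ 2)%N.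
  have : (#|Bd|%:Z * n%:Z ^+ 2 <= 4 * (e%:Z ^+ 2 * n%:Z * q%:Z + e%:Z * n%:Z ^+ 2))%R by lia.
  rewrite !expr2 => hz.
  have h : (#|Bd| * n ^ 2 <= 4 * (e ^ 2 * n * q + e * n ^ 2))%N.
    by rewrite -!mulnn; move: hz; clear; move: #|Bd| => B; lia.
  apply: leq_trans h _.
  have h1 : (e * n ^ 2 <= e ^ 2 * (D * n ^ 2))%N.
    have D0 : (0 < D)%N by case: D FD => //; rewrite mul0n leqNgt q0.
    move: (n ^ 2)%N => N; rewrite -mulnn -mulnA leq_pmul2l // mulnA leq_pmull //.
    by rewrite muln_gt0 e0.
  have h2 : (e ^ 2 * n * q <= e ^ 2 * (D * n ^ 2))%N.
    rewrite -mulnA leq_mul2l -[(n ^ 2)%N]mulnn [(D * _)%N]mulnA [(n * q)%N]mulnC leq_mul2r FD.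
    by rewrite !orbT.
  by lia.
by move: main; rewrite leq_pmul2r // expn_gt0 n0.
Qed.

End Cyclotomy.

(** * Embedding coloured cliques, and designs from difference families *)

Section CyclotomicDesign.
Local Open Scope ring_scope.

(* Each choice of a point shrinks the remaining candidate sets by a factor at
   most [2 * e], outside boundedly many exceptional points. *)
Lemma cyc_embedding (e l : nat) : (0 < e)%N -> forall D : nat, exists Q0 : nat,
  forall (F : finFieldType) (f : nat), (0 < f)%N -> #|F| = (e * f).+1 -> (Q0 <= #|F|)%N ->
  forall (S : nat -> {set F}) (col : nat -> nat -> F),
    (forall i, (i < l)%N -> (#|F| <= D * #|S i|)%N) ->
    (forall i j, (i < j < l)%N -> col i j \in cyc_classes F f) ->
  exists a : nat -> F, (forall i, (i < l)%N -> a i \in S i) /\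
    (forall i j, (i < j < l)%N -> (a j - a i) ^+ f = col i j).
Proof.
move=> e0; elim: l => [|l IH] D.
  by exists 0%N => F f _ _ _ S col _ _; exists (fun=> 0); split=> // i j; rewrite ltn0 andbF.
have [Q0 QP] := IH (D * (2 * e))%N.
(* The middle term makes [S 0] larger than the union of the exceptional sets for the [l] later
   candidate sets, so a good first point exists. *)
exists (Q0 + D * (l * (8 * e ^ 2 * D)) + 1)%N => F f f0 cF hQ S col hS hcol.
pose Bd i := [set x | [exists v in cyc_classes F f, 2 * e * #|cyc_nbrs f (S i) v x| < #|S i|]]%N.
have cBd i : (i < l)%N -> (#|Bd i.+1| <= 8 * e ^ 2 * D)%N.
  by move=> il; apply: (card_cyc_bad e0 f0 cF); apply: hS.
have [x xS xgood] : exists2 x, x \in S 0%N & forall i, (i < l)%N -> x \notin Bd i.+1.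
  pose U := \bigcup_(i < l) Bd i.+1.
  have cU : (#|U| <= l * (8 * e ^ 2 * D))%N.
    rewrite -[X in (X * _)%N](card_ord l) -sum_nat_const.
    apply: leq_trans (leq_sum _ (fun (i : 'I_l) _ => cBd i (ltn_ord i))).
    rewrite /U; elim/big_rec2: _ => [|i y B _ h]; first by rewrite cards0.
    by rewrite (leq_trans (leq_card_setU _ _)) // leq_add2l.
  have /subsetPn[x xS xU] : ~~ (S 0%N \subset U).
    apply/negP => /subset_leq_card sU; have := hS 0%N isT.
    have : (D * #|S 0%N| <= D * (l * (8 * e ^ 2 * D)))%N.
      by rewrite leq_mul2l (leq_trans sU) ?orbT.
    by lia.
  exists x => // i il; apply: contra xU => xB.
  by apply/bigcupP; exists (Ordinal il).
have [|||a [aS aP]] := QP F f f0 cF _ (fun i => cyc_nbrs f (S i.+1) (col 0%N i.+1) x)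
    (fun i j => col i.+1 j.+1).
- by lia.
- move=> i il; have := xgood i il; rewrite inE negb_exists_in => /forall_inP.
  move/(_ (col 0%N i.+1)); rewrite hcol // -leqNgt => /(_ isT) h.
  by apply: leq_trans (hS i.+1 il) _; rewrite -mulnA leq_mul2l h orbT.
- by move=> i j ij; apply: hcol.
exists (fun i => if i is i'.+1 then a i' else x); split.
  by case=> [|i] // il; have := aS i il; rewrite inE => /andP[].
case=> [|i] [|j] //=.
  by rewrite ltnS => jl; have := aS j jl; rewrite inE => /andP[_ /eqP].
by move=> ij; apply: aP.
Qed.

Lemma card_ltn_pairs k : #|[set p : 'I_k * 'I_k | (p.1 < p.2)%N]| = 'C(k, 2).
Proof.
rewrite -(card_imset _ (f := fun p : 'I_k * 'I_k => (p.2, p.1))); last by move=> [? ?] [? ?] [-> ->].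
have -> : [set (p.2, p.1) | p in [set p : 'I_k * 'I_k | (p.1 < p.2)%N]] =
    [set p : 'I_k * 'I_k | (p.2 < p.1)%N].
  apply/setP => -[i j]; rewrite !inE; apply/imsetP/idP => [[p]|h]; first by rewrite inE => ? [-> ->].
  by exists (j, i); rewrite ?inE.
rewrite (card_pairs_sum (fun i j : 'I_k => (j < i)%N)) -bin2_sum big_mkord; apply: eq_bigr => i _.
rewrite -[RHS](card_ord i) -[RHS](card_imset _ (f := widen_ord (ltnW (ltn_ord i)))).
  apply: eq_card => j; rewrite inE; apply/idP/imsetP => [ji|[j' _ ->]]; last exact: (ltn_ord j').
  by exists (Ordinal ji) => //; apply: val_inj.
by move=> j j' /(congr1 val) /= /val_inj.
Qed.

Lemma odd_card_opp1 (F : finFieldType) : odd #|F| -> (-1 : F) != 1.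
Proof.
move=> oF; apply/eqP => e1.
have c2 : 2%N \in [pchar F].
  by apply/andP; split=> //; rewrite /= mulr2n -{1}e1 addNr eqxx.
have := card_pprimeChar c2; have : (1 < #|F|)%N.
  by apply/card_gt1P; exists 0, 1; rewrite eq_sym oner_neq0.
move=> q1 eq; move: oF; rewrite eq oddX /= orbF => /eqP l0.
by move: q1; rewrite eq l0.
Qed.

(** Put [e = 'C(k, 2)] and choose [k] elements [a i] whose differences with [i < j] represent each
    coset of the [e]-th powers once. The multiples of this base block by one [e]-th power from each
    pair [h], [- h] form a difference family, and their translates are the blocks. *)
Lemma GD_cyclotomic k : (1 < k)%N -> exists Q0 : nat, forall F : finFieldType,
  (k * (k - 1) %| #|F| - 1)%N -> (Q0 <= #|F|)%N -> GD k #|F| 1.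
Proof.
move=> k1; pose e := 'C(k, 2).
have e0 : (0 < e)%N by rewrite bin_gt0.
have [Q0 QP] := cyc_embedding k e0 1%N.
exists (Q0 + 2)%N => F /dvdnP[m em] hQ.
have ek : (k * (k - 1) = e * 2)%N.
  by rewrite /e; have := mul_bin_diag k 1; rewrite bin1 -subn1 => ->; rewrite mulnC.
pose f := (2 * m)%N.
have cF : #|F| = (e * f).+1.
  have : (#|F| = m * (e * 2) + 1)%N by rewrite -ek -em; lia.
  by rewrite /f => ->; rewrite addn1 mulnCA [(2 * m)%N]mulnC mulnA.
have f0 : (0 < f)%N by rewrite lt0n; apply/eqP => f0; move: hQ; rewrite cF f0 muln0; lia.
have odF : odd #|F| by rewrite cF /= oddM /f oddM /= andbF.
have sgn (x : F) : (- x) ^+ f = x ^+ f by rewrite /f !exprM sqrrN.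
pose X := cyc_classes F f; have [cX _] := card_cyc e0 f0 cF.
pose prs := enum [set p : 'I_k * 'I_k | (p.1 < p.2)%N].
have sprs : size prs = e by rewrite -cardE card_ltn_pairs.
pose col0 (p : 'I_k * 'I_k) : F := nth 0 (enum X) (index p prs).
have mprs (i j : 'I_k) : ((i, j) \in prs) = (i < j)%N by rewrite mem_enum inE.
have k0 : (0 < k)%N by lia.
pose o n : 'I_k := insubd (Ordinal k0) n.
have oK n : (n < k)%N -> o n = n :> nat by move=> nk; rewrite /o val_insubd nk.
have szX : size (enum X) = e by rewrite -cardE cX.
have [|||a [_ aP]] := QP F f f0 cF _ (fun=> setT) (fun i j => col0 (o i, o j)).
- by lia.
- by move=> i _; rewrite cardsT mul1n.
- move=> i j /andP[ij jk]; rewrite /col0 -(mem_enum X) mem_nth // szX -sprs index_mem mprs.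
  by rewrite !oK // (ltn_trans ij).
have aP' (i j : 'I_k) : (i < j)%N -> (a j - a i) ^+ f = col0 (i, j).
  move=> ij; rewrite aP ?ij ?ltn_ord //; congr (col0 (_, _)); apply: val_inj; rewrite /= oK //.
have col0I p p' : p \in prs -> p' \in prs -> col0 p = col0 p' -> p = p'.
  move=> pp pp' /eqP; rewrite nth_uniq ?enum_uniq ?szX -?sprs ?index_mem // => /eqP ei.
  by rewrite -(nth_index p pp) ei nth_index.
have col0S v : v \in X -> exists2 p : 'I_k * 'I_k, (p.1 < p.2)%N & col0 p = v.
  move=> vX; have vi : (index v (enum X) < size prs)%N by rewrite sprs -szX index_mem mem_enum.
  pose p := nth (o 0%N, o 0%N) prs (index v (enum X)).
  have pp : p \in prs by apply: mem_nth.
  exists p; first by move: pp; rewrite mem_enum inE.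
  by rewrite /col0 /p index_uniq ?enum_uniq // nth_index // mem_enum.
have col0X (i j : 'I_k) : (i < j)%N -> col0 (i, j) != 0.
  move=> ij; apply: (cyc_classes_neq0 (f := f)).
  by rewrite -/X -(mem_enum X) mem_nth // szX -sprs index_mem mprs.
have aI (i j : 'I_k) : i != j -> a i - a j != 0.
  wlog ij : i j / (i < j)%N => [hw nij|_].
    case: (ltngtP i j) => [/hw|ji|/val_inj eij]; [exact| |by rewrite eij eqxx in nij].
    by rewrite -opprB oppr_eq0; apply: hw; rewrite // eq_sym.
  rewrite -opprB oppr_eq0; apply: contra_neq (col0X i j ij) => h.
  by rewrite -aP' // h expr0n eqn0Ngt f0.
have pairI (i j i' j' : 'I_k) : i != j -> i' != j' ->
    (a i - a j) ^+ f = (a i' - a j') ^+ f -> (i = i' /\ j = j') \/ (i = j' /\ j = i').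
  move=> nij nij'.
  have srt (u v : 'I_k) : u != v -> exists2 p : 'I_k * 'I_k, (a u - a v) ^+ f = col0 p & 
      p \in prs /\ (p = (u, v) \/ p = (v, u)).
    move=> nuv; case: (ltngtP u v) => [uv|vu|/val_inj euv]; last by rewrite euv eqxx in nuv.
      by exists (u, v); rewrite ?mprs //; [rewrite -sgn opprB aP'|split=> //; left].
    by exists (v, u); rewrite ?mprs //; [rewrite aP'|split=> //; right].
  have [p -> [pp hp]] := srt i j nij; have [p' -> [pp' hp']] := srt i' j' nij'.
  move=> /(col0I _ _ pp pp') ep; rewrite -ep in hp'.
  by case: hp hp' => -> [] [-> ->]; auto.
have neg (h : F) : h != 0 -> h != - h.
  move=> h0; apply/eqP => eh; case/eqP: (odd_card_opp1 odF); apply: (mulIf h0).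
  by rewrite mulN1r mul1r -eh.
(* The condition [h ^+ f = 1] describes the [e]-th powers; as [f] is even they are closed under
   negation, and [h != - h] in odd characteristic, so the enumeration order picks one of each
   pair. *)
pose half : finType := {h : F | (h ^+ f == 1) && (enum_rank h < enum_rank (- h))%N}.
have half0 (h : half) : val h != 0.
  have /andP[/eqP h1 _] := valP h; apply: contra_eq_neq h1 => ->.
  by rewrite expr0n eqn0Ngt f0 eq_sym oner_neq0.
pose beta (j : half * F) := [set val j.1 * a i + j.2 | i : 'I_k].
apply: (proj1 (GD1P k F)); apply: (@decomposable_family _ _ _ beta).
- move=> j; rewrite card_imset ?card_ord // => i i' /addIr /(mulfI (half0 _)) ea.
  by apply/eqP; apply: contraT => /aI; rewrite ea subrr eqxx.
- by [].
- move=> x y nxy _.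
  have xy0 : x - y != 0 by rewrite subr_eq0.
  have [[i j] /= ij cp] := col0S _ (mem_cyc_classes f xy0).
  have d0 : a j - a i != 0 by apply: aI; rewrite neq_ltn ij orbT.
  pose h := (x - y) / (a j - a i).
  have eh : h * (a j - a i) = x - y by rewrite divfK.
  have h0 : h != 0 by rewrite mulf_neq0 ?invr_eq0.
  have h1 : h ^+ f == 1 by rewrite expr_div_n -cp -aP' // divff // expf_neq0.
  case: (ltngtP (enum_rank h) (enum_rank (- h))) => [lh|lh|/val_inj/enum_rank_inj e1]; last first.
  + by have := neg h h0; rewrite -e1 eqxx.
  + have hh : ((- h) ^+ f == 1) && (enum_rank (- h) < enum_rank (- - h))%N by rewrite sgn h1 opprK.
    exists (exist _ (- h) hh, x + h * a i); split; apply/imsetP; [exists i | exists j] => //=.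
      by ring.
    by rewrite -[LHS](subKr x) -eh; ring.
  have hh : (h ^+ f == 1) && (enum_rank h < enum_rank (- h))%N by rewrite h1.
  exists (exist _ h hh, y - h * a i); split; apply/imsetP; [exists j | exists i] => //=.
    by rewrite -[LHS](subrK y) -eh; ring.
  by ring.
move=> [s t] [s' t'] x y nxy /imsetP[i _ ex] /imsetP[j _ ey] /imsetP[i' _ ex'] /imsetP[j' _ ey'].
rewrite /= in ex ey ex' ey'.
have nij : i != j by apply: contraNneq nxy => e1; rewrite ex ey e1.
have nij' : i' != j' by apply: contraNneq nxy => e1; rewrite ex' ey' e1.
have d1 : x - y = val s * (a i - a j) by rewrite ex ey opprD addrACA subrr addr0 mulrBr.
have d2 : x - y = val s' * (a i' - a j') by rewrite ex' ey' opprD addrACA subrr addr0 mulrBr.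
have /andP[/eqP s1 ls] := valP s; have /andP[/eqP s1' ls'] := valP s'.
have : (a i - a j) ^+ f = (a i' - a j') ^+ f.
  by have := congr1 (fun z => z ^+ f) d1; rewrite d2 !exprMn s1 s1' !mul1r.
case/(pairI i j i' j' nij nij') => [[ei ej]|[ei ej]].
  rewrite -ei -ej in d2 ex'.
  have es : s = s' by apply: val_inj; apply: (mulIf (aI i j nij)); rewrite -d1 -d2.
  by move: ex'; rewrite -es ex => /addrI ->.
have es : val s = - val s'.
  by apply: (mulIf (aI i j nij)); rewrite -d1 d2 -ei -ej; ring.
by move: ls; rewrite es opprK ltnNge ltnW.
Qed.

End CyclotomicDesign.

(** * Residue classes *)

(** Euler's theorem for a prime above [M]; the factor [b.+1] in the exponent makes the power
    large. *)
Lemma prime_power_mod M b : 0 < M ->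
  exists p n, [/\ prime p, 0 < n, b <= p ^ n & M %| p ^ n - 1].
Proof.
move=> M0; have [p pM pp] := prime_above M.
have coM : coprime p M by rewrite prime_coprime //; apply/negP => /(dvdn_leq M0); rewrite leqNgt pM.
exists p, (totient M * b.+1); split=> //.
- by rewrite muln_gt0 totient_gt0 M0.
- apply: (@leq_trans (totient M * b.+1)); last by apply/ltnW/ltn_expl/prime_gt1.
  by rewrite (leq_trans (leqnSn b)) // leq_pmull // totient_gt0.
- rewrite -eqn_mod_dvd ?expn_gt0 ?prime_gt0 // expnM -modnXm Euler_exp_totient //.
  by rewrite modnXm exp1n.
Qed.

(** Unlike in [GD_fill], each group is filled on its own points, with no group adjoined. *)
Lemma GD_fill_groups k m a g : GD k m (a * g) -> GD k a g -> GD k (m * a) g.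
Proof.
move=> gd1 gd2.
pose T' (j : option 'I_m) : finType :=
  if j is Some i then ('I_a * 'I_g)%type else ('I_m * ('I_a * 'I_g))%type.
pose f (j : option 'I_m) : T' j -> ('I_m * 'I_a) * 'I_g :=
  match j with
  | Some i => fun x : 'I_a * 'I_g => ((i, x.1), x.2)
  | None => fun x : 'I_m * ('I_a * 'I_g) => ((x.1, x.2.1), x.2.2)
  end.
pose E' (j : option 'I_m) : rel (T' j) :=
  match j with
  | Some i => fun x y : 'I_a * 'I_g => x.1 != y.1
  | None => fun x y : 'I_m * ('I_a * 'I_g) => x.1 != y.1
  end.
apply: (@decomposable_GD _ _ _ ('I_m * 'I_a)%type 'I_g); rewrite ?card_prod ?card_ord //.
apply: (@decomposable_glue k _ _ T' f _ E').
- case=> [i|] /=; first by move=> [x y] [x' y'] /= [-> ->].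
  by move=> [i [x y]] [i' [x' y']] /= [-> -> ->].
- case=> [i|] //=; apply: (GD_decomposable gd1); rewrite ?card_prod ?card_ord //.
- case=> [i|] /=; first by move=> [x y] [x' y'] /= _; apply: contraNneq => -[->].
  by move=> [i [x y]] [i' [x' y']] /= _; apply: contraNneq => -[->].
- move=> [[i x] y] [[i' x'] y'] /= _ n.
  have [ei|ni] := eqVneq i i'; last by exists None, (i, (x, y)), (i', (x', y')).
  rewrite -ei in n *; exists (Some i), (x, y), (x', y'); split=> //=.
  by apply: contraNneq n => ->.
- case=> [i|] /=.
    move=> [x y] [x' y'] [j|] /=; first by move=> [c d] [c' d'] _ _ _ [->].
    by move=> [c [d e]] [c' [d' e']] /= _ _ /eqP nc [e1 _ _] [e2 _ _]; case: nc; congruence.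
  move=> [i [x y]] [i' [x' y']] [j|] //= [c d] [c' d'] /=.
  by move=> _ /eqP ni _ [e1 _ _] [e2 _ _]; case: ni; congruence.
Qed.

(** For a field of suitable order [q], [GD_field] gives [u] groups of size [q ^ k], and each group
    is filled with the cyclotomic design over the field with [q ^ k] elements. As [q] is 1 modulo
    [Q], the number of points stays in the class of [u] modulo [u * Q]. *)
Lemma GD_fiber k u Q : 1 < k -> k.+2 <= u -> k - 1 %| u - 1 -> k * (k - 1) %| u * (u - 1) ->
  0 < Q -> exists z, GD k (u * (1 + Q * z)) 1.
Proof.
move=> k1 ku d1 d2 Q0.
have [|||mu [B0 [mu0 hF]]] := @GD_field k u 1 k1 ku; rewrite ?mul1n //.
have [B1 hC] := GD_cyclotomic k1.
have kk0 : 0 < k * (k - 1) by rewrite muln_gt0; lia.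
have M0 : 0 < mu * (Q * (k * (k - 1))) by rewrite !muln_gt0 mu0 Q0 -muln_gt0.
have [p [n [pp n0 bq dq]]] := prime_power_mod (B0 + B1) M0.
have [F _ cF] := pPrimePowerField pp n0.
have nk0 : 0 < n * k by rewrite muln_gt0 n0; lia.
have [F' _ cF'] := pPrimePowerField pp nk0.
have qk1 : p ^ n <= p ^ (n * k) by rewrite leq_pexp2l ?prime_gt0 // leq_pmulr; lia.
have dqk : p ^ n - 1 %| p ^ (n * k) - 1.
  by rewrite expnM -{2}(exp1n k) subn_exp dvdn_mulr.
have dQ : Q %| p ^ (n * k) - 1.
  by apply: dvdn_trans dqk; apply: dvdn_trans dq; rewrite dvdn_mull // dvdn_mulr.
have gu := hF F; rewrite cF mul1n -expnM in gu.
have gN := hC F'; rewrite cF' in gN.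
have [z ez] := dvdnP dQ; exists z.
have -> : 1 + Q * z = p ^ (n * k).
  by rewrite mulnC -ez addnC subnK // expn_gt0 prime_gt0.
apply: GD_fill_groups; rewrite ?muln1.
  by apply: gu; [apply: dvdn_trans dq; apply: dvdn_mulr | rewrite (leq_trans _ bq) ?leq_addr].
apply: gN; last by rewrite (leq_trans _ qk1) // (leq_trans _ bq) ?leq_addl.
by apply: dvdn_trans dqk; apply: dvdn_trans dq; rewrite dvdn_mull // dvdn_mull.
Qed.

(** A group size divisible by [k * (k - 1)] makes the divisibility conditions hold for every [u].
    One field serves the finitely many [u] of the initial interval, and truncated transversal
    designs reach all the others. *)
Lemma GD_all_ge k : 1 < k ->
  exists G, [/\ 0 < G, k * (k - 1) %| G & forall m, k.+2 <= m -> GD k m G].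
Proof.
move=> k1; pose a := k.+2; pose H := a * (a * a`! + a + 2 * a`!) + a.
pose g := k * (k - 1); have g0 : 0 < g by rewrite muln_gt0; lia.
have /fin_all_exists[mB mBP] : forall u : 'I_H.+1, exists mB : nat * nat, 0 < mB.1 /\
    (a <= u -> forall F : finFieldType, mB.1 %| #|F| - 1 -> mB.2 <= #|F| -> GD k u (g * #|F| ^ k)).
  move=> u; have [au|au] := leqP a u; last by exists (1, 0).
  have [||mu [B0 [mu0 hF]]] := @GD_field k u g k1 au g0.
  - by apply: dvdn_mulr; apply: dvdn_mull.
  - by rewrite -mulnA; apply: dvdn_mulr.
  by exists (mu, B0).
pose M := \prod_(u < H.+1) (mB u).1; pose B := \sum_(u < H.+1) (mB u).2.
have M0 : 0 < M by apply: prodn_gt0 => u; case: (mBP u).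
have [p [n [pp n0 bq dq]]] := prime_power_mod B M0.
have [F _ cF] := pPrimePowerField pp n0.
exists (g * #|F| ^ k); split.
- by rewrite muln_gt0 g0 cF !expn_gt0 prime_gt0.
- exact: dvdn_mulr.
apply: (@closed_ge_of_interval (fun m => GD k m (g * #|F| ^ k)) a) => // [n' t|u /andP[au uH]].
  by move=> *; apply: GD_truncated_TD.
have [_] := mBP (Ordinal (uH : u < H.+1)); apply=> //.
  by rewrite cF; apply: dvdn_trans dq; rewrite /M (bigD1 (Ordinal (uH : u < H.+1))) //= dvdn_mulr.
by rewrite cF (leq_trans _ bq) // /B (bigD1 (Ordinal (uH : u < H.+1))) //= leq_addr.
Qed.

(* Both classes come from filling the groups of [GD k m (G * c)], adjoining one point
   or the points of one block; [c = 1] modulo [k`!] makes [GD k k c] available. *)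
Lemma GD_two_classes k : 1 < k -> exists L, [/\ 0 < L, k %| L &
  forall x, k.+2 <= x -> GD k (x * L) (k - 1) /\ GD k (x * L).+1 (k - 1)].
Proof.
move=> k1; have [G [G0 dG hG]] := GD_all_ge k1.
have [h [eG kh]] : exists h, G = (k - 1) * h /\ k %| h.
  by have [y ->] := dvdnP dG; exists (y * k); split; [ring | apply: dvdn_mull].
have h0 : 0 < h by move: G0; rewrite eG muln_gt0 => /andP[].
have kG : k <= G by apply: leq_trans (dvdn_leq G0 dG); rewrite leq_pmulr // subn_gt0.
(* The trivial block designs on [w = 1] and [w = k] points are admissible. Shifting [w] by a
   multiple of [G] makes it large enough for [GD_fiber], and the modulus [G * f] keeps [c] congruent
   to 1 modulo [f], the factorial of [k]. *)
have rep w : 0 < w -> k - 1 %| w - 1 -> k * (k - 1) %| w * (w - 1) -> exists c,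
    [/\ 1 < c, coprime c k.-1`! & GD k (w + G * c) 1].
  have := fact_gt0 k; have : k.-1`! %| k`! by rewrite -{2}(prednK (ltnW k1)) factS dvdn_mull.
  move: k`! k.-1`! => f f' ff f0 w0 dw1 dw2; pose u := w + G * (1 + f).
  have [||||z gz] := @GD_fiber k u (G * f) k1.
  - rewrite /u; have : G * 2 <= G * (1 + f) by rewrite leq_mul2l ltnS f0 orbT.
    by move: (G * (1 + f)) => X; clear -kG k1 w0; lia.
  - rewrite /u addnC -addnBA // dvdn_addr //.
    by rewrite eG -mulnA dvdn_mulr.
  - have -> : u * (u - 1) = w * (w - 1) + G * ((1 + f) * (w + (w - 1) + G * (1 + f))).
      by rewrite /u; case: (w) w0 => // w' _; rewrite addSn !subn1 /=; ring.
    by rewrite dvdn_addr //; apply: dvdn_mulr.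
  - by rewrite muln_gt0 G0.
  exists (1 + f * (1 + u * z)); split.
  - by rewrite -addn1 leq_add2l muln_gt0 f0.
  - apply: coprime_dvdr ff _.
    by rewrite coprime_sym /coprime addnC mulnC gcdnMDl gcdn1.
  - by move: gz; congr (GD k _ 1); rewrite /u; ring.
have [c0 [c01 co0 g0]] := rep 1 isT ltac:(by rewrite subnn) ltac:(by rewrite subnn muln0).
have [c1 [c11 co1 g1]] := rep k ltac:(lia) (dvdnn _) (dvdnn _).
(* Each class needs its own group size, [G * c0] or [G * c1]; this product is a common period, whose
   other factor goes into the number [m] of groups. *)
exists (h * c0 * (h * c1)); split.
- by rewrite !muln_gt0 h0 (ltnW c01) (ltnW c11).
- by rewrite -mulnA dvdn_mulr.
move=> x kx; split.
  have -> : x * (h * c0 * (h * c1)) = x * (h * c1) * (h * c0) by ring.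
  set m := x * (h * c1).
  have km : k.+2 <= m by rewrite (leq_trans kx) // leq_pmulr // muln_gt0 h0 ltnW.
  apply: GD_delete_point => //.
  have := GD_fill (k := k) (m := m) (a := G * c0) (g := 1).
  rewrite muln1 -add1n => /(_ (GD_mul c01 co0 (hG m km)) g0).
  by congr (GD k _.+1 1); rewrite eG; ring.
have -> : x * (h * c0 * (h * c1)) = x * (h * c0) * (h * c1) by ring.
set m := x * (h * c0).
have km : k.+2 <= m by rewrite (leq_trans kx) // leq_pmulr // muln_gt0 h0 ltnW.
apply: GD_fill.
  by have := GD_mul c11 co1 (hG m km); congr (GD k m _); rewrite eG; ring.
apply: GD_delete_point => //; move: g1; congr (GD k _ 1); rewrite eG.
by case: (k) k1 => // k' _; rewrite subn1 /=; ring.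
Qed.

Lemma admissible_mod k x y : x = y %[mod k] -> k %| x * (x - 1) -> k %| y * (y - 1).
Proof.
have E z : (k %| z * (z - 1)) = (z * z == z %[mod k]).
  rewrite mulnBr muln1 eqn_mod_dvd //.
  by case: z => // z; rewrite leq_pmulr.
by rewrite !E => exy; rewrite -modnMm exy modnMm.
Qed.

(** [GD_fiber] is applied to [u = (k - 1) * r' + 1] with modulus [(k - 1) * Q]. Its design has
    [(k - 1) * (r' + u * Q * z) + 1] points, and deleting one of them leaves a number of groups
    congruent to [r]. The shift from [r] to [r'] only makes [u] large. *)
Lemma GD_representative k r Q : 1 < k -> k %| r * (r - 1) -> 0 < Q ->
  exists t, GD k t (k - 1) /\ t = r %[mod Q].
Proof.
move=> k1 dr Q0; pose r' := r + k * Q * 3.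
have dr' : k %| r' * (r' - 1).
  by apply: admissible_mod dr; rewrite /r' -mulnA addnC mulnC modnMDl.
have kr' : k * 3 <= r' by rewrite /r' mulnAC (leq_trans _ (leq_addl _ _)) // leq_pmulr.
have ru : r' <= (k - 1) * r' by rewrite leq_pmull // subn_gt0.
pose u := (k - 1) * r' + 1.
have [||||z gz] := @GD_fiber k u ((k - 1) * Q) k1.
- by rewrite /u; move: ((k - 1) * r') ru kr' => X; clear -k1; lia.
- by rewrite /u addnK dvdn_mulr.
- rewrite /u addnK mulnCA [k * _]mulnC dvdn_pmul2l ?subn_gt0 //.
  (* Modulo [k] one has [u = 1 - r'], so [u * r'] and [r' * (r' - 1)] are opposite. *)
  have : k %| ((k - 1) * r' + 1) * r' + r' * (r' - 1).
    have -> : ((k - 1) * r' + 1) * r' + r' * (r' - 1) = k * (r' * r').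
      have : 0 < r' by apply: leq_trans kr'; rewrite muln_gt0 (ltnW k1).
      by clear -k1; move: r' => [//|r1] _; rewrite subn1 /=; move: k k1 => [//|k'] _; rewrite subn1 /=; ring.
    exact: dvdn_mulr.
  by rewrite dvdn_addl.
- by rewrite muln_gt0 subn_gt0 k1.
exists (r' + u * Q * z); split.
  apply: GD_delete_point => //; move: gz; congr (GD k _ 1).
  by rewrite mulnDr muln1 -[X in X + _]/((k - 1) * r' + 1) -addn1; move: (u) => w; ring.
by rewrite -mulnA mulnCA addnC mulnC modnMDl /r' addnC -mulnA mulnCA mulnC modnMDl.
Qed.

(** * Affine spaces and dimension *)

Section AffineLines.
Local Open Scope ring_scope.
Variables (F : finFieldType) (n : nat).
Local Notation P := 'rV[F]_n.

Definition line (x y : P) : {set P} := [set x + c *: (y - x) | c : F].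
Definition lines : {set {set P}} := [set line p.1 p.2 | p in [set p : P * P | p.1 != p.2]].

Lemma card_line x y : x != y -> #|line x y| = #|F|.
Proof.
move=> nxy; rewrite card_imset // => c c' /addrI /eqP.
by rewrite -subr_eq0 -scalerBl scaler_eq0 subr_eq0 [_ - _ == 0]subr_eq0 [y == x]eq_sym (negPf nxy) orbF => /eqP.
Qed.

Lemma line_eq l x y : l \in lines -> x != y -> x \in l -> y \in l -> l = line x y.
Proof.
case/imsetP=> -[p q]; rewrite inE /= => npq -> nxy /imsetP[c _ ex] /imsetP[c' _ ey].
apply/eqP; rewrite eqEcard !card_line // leqnn andbT; apply/subsetP => z /imsetP[s _ ->].
have dc : c' - c != 0 by rewrite subr_eq0; apply: contraNneq nxy => e; rewrite ex ey e.
apply/imsetP; exists ((s - c) / (c' - c)) => //.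
have -> : y - x = (c' - c) *: (q - p).
  by rewrite ey ex opprD addrACA subrr add0r -scalerBl.
by rewrite scalerA divfK // ex -addrA -scalerDl [c + _]addrC subrK.
Qed.

Lemma line_ex (x y : P) : x != y -> exists2 l, l \in lines & x \in l /\ y \in l.
Proof.
move=> nxy; exists (line x y); first by apply/imsetP; exists (x, y); rewrite ?inE.
by split; apply/imsetP; [exists 0; rewrite ?scale0r ?addr0 | exists 1; rewrite ?scale1r 1?addrC ?subrK].
Qed.

Lemma line_hyperplane l x y (u : 'cV[F]_n) : l \in lines -> x != y -> x \in l -> y \in l ->
  x *m u = 0 -> y *m u = 0 -> forall z, z \in l -> z *m u = 0.
Proof.
move=> ll nxy xl yl xu yu z; rewrite (line_eq ll nxy xl yl) => /imsetP[c _ ->].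
by rewrite mulmxDl -scalemxAl mulmxBl xu yu subrr scaler0 addr0.
Qed.

End AffineLines.

(** At most [d] vectors span a subspace of rank at most [d], so a nonzero linear form kills them
    all; the matrix [A] is padded with zero rows. *)
Lemma hyperplane_through (F : fieldType) (d : nat) (s : seq 'rV[F]_d.+1) : size s <= d ->
  exists2 u : 'cV[F]_d.+1, u != 0%R & forall x, x \in s -> (x *m u = 0)%R.
Proof.
move=> sd; pose A := (\matrix_(i < d) nth 0 s i)%R : 'M[F]_(d, d.+1).
have : kermx A^T != 0%R.
  rewrite kermx_eq0 /row_free mxrank_tr neq_ltn (leq_ltn_trans (rank_leq_row A)) //.
case/rowV0Pn=> u /sub_kermxP uA u0; exists (u^T)%R.
  by apply: contra_neq u0 => h; rewrite -[u]trmxK h trmx0.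
move=> x xs; have xi : index x s < d by rewrite (leq_trans _ sd) // index_mem.
have -> : x = row (Ordinal xi) A by rewrite rowK /= nth_index.
by rewrite -row_mul -[A]trmxK -trmx_mul uA trmx0 row0.
Qed.

(** * Transfer to block designs and choice of the parameters *)

Lemma PBD_transport k d v (W : finType) (B : {set {set W}}) :
  #|W| = v -> clique_dec k (fun x y => x != y) B ->
  (forall Y : {set W}, #|Y| <= d -> exists X : {set W},
     [/\ forall b x y, b \in B -> x != y -> x \in b -> y \in b -> x \in X -> y \in X -> b \subset X,
         X != setT & Y \subset X]) ->
  exists B : {set {set 'I_v}}, is_PBD_k k B /\ dim_at_least B d.
Proof.
move=> <- [cB eB vB uB] dimB; pose f : W -> 'I_#|W| := enum_rank.
have fI : injective f := @enum_rank_inj W.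
have fS x : exists y, x = f y by exists (enum_val x); rewrite /f enum_valK.
have fm (A : {set W}) x : (f x \in f @: A) = (x \in A) by rewrite (mem_imset _ _ fI).
exists [set f @: b | b : {set W} in B]; split; first split.
- by move=> _ /imsetP[b bB ->]; rewrite card_imset //; apply: cB.
- move=> x y; have [x' ->] := fS x; have [y' ->] := fS y; rewrite (inj_eq fI) => nxy.
  have [b bB [xb yb]] := vB _ _ nxy nxy; exists (f @: b); split.
    by rewrite !fm; split=> //; apply: imset_f.
  move=> _ [/imsetP[b' b'B ->]]; rewrite !fm => -[xb' yb'].
  by rewrite (uB b b' x' y').
move=> Y cY; have [|X [subX ntX YX]] := dimB (f @^-1: Y).
  by rewrite on_card_preimset //; apply: (onW_bij _ (Bijective (@enum_rankK W) (@enum_valK W))).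
exists (f @: X); split.
- move=> _ /imsetP[b bB ->] x y; have [x' ->] := fS x; have [y' ->] := fS y.
  rewrite (inj_eq fI) !fm => nxy xX yX xb yb; apply: imsetS.
  exact: (subX b x' y').
- apply: contra_neq ntX => h; apply/setP => x; rewrite inE -fm h inE //.
- apply/subsetP => y; have [y' ->] := fS y; rewrite fm => yY.
  by apply: (subsetP YX); rewrite inE.
Qed.

(** Affine space is inflated by [n], truncated over the origin to [t], given weight [k - 1], and
    completed by one point at infinity, which turns every group into a block of size [k]. The points
    projecting into a hyperplane through the origin form a proper subspace, and any [d] projections
    lie in such a hyperplane. *)
Lemma PBD_of_parameters k d n t (F : finFieldType) : 1 < k -> 1 < n ->
  coprime n #|{: 'rV[F]_d.+1}|`! -> t <= n ->
  GD k n (k - 1) -> GD k t (k - 1) -> GD k #|F| (k - 1) -> GD k #|F|.-1 (k - 1) ->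
  exists B : {set {set 'I_((#|{: 'rV[F]_d.+1}|.-1 * n + t) * (k - 1)).+1}},
    is_PBD_k k B /\ dim_at_least B d.
Proof.
move=> k1 n1 co tn gn gt gq gq1; pose P : finType := 'rV[F]_d.+1.
have cZ : #|{: 'Z_n}| = n by rewrite card_ord Zp_cast.
have [U cU] : exists U : {set 'Z_n}, #|U| = t.
  have /card_geqP[r [ur sr _]] : t <= #|{: 'Z_n}| by rewrite cZ.
  by exists [set x in r]; rewrite cardsE -sr; apply/card_uniqP.
pose A : finType := ('I_(k - 1) * 'I_1)%type.
have cA : #|A| = k - 1 by rewrite card_prod !card_ord muln1.
have [||||||B0 [dec0 part0]] := @clique_dec_trunc k A P 0%R (lines F d.+1) ('Z_n)
    (fun x => (enum_rank x)%:R)%R U.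
- exact: line_ex.
- by move=> l l' x y ll ll' nxy xl yl xl' yl'; rewrite (line_eq ll nxy xl yl) (line_eq ll' nxy xl' yl').
- move=> x y nxy; apply: (unit_natrB_Zp n1 co); rewrite 1?ltnW // (inj_eq (@ord_inj _)).
  by rewrite (inj_eq enum_rank_inj).
- by rewrite cZ cA.
- by rewrite cU cA.
- move=> l /imsetP[[x y]]; rewrite inE /= => nxy ->; rewrite cA card_line //; split=> //.
  have := cardsD1 (0%R : P) (line x y); rewrite card_line //; case: (_ \in _) => /= e.
    by move: gq1; rewrite e.
  by move: gq; rewrite e.
have [|B' [dec' part']] := clique_dec_fill dec0
    (GD_decomposable (I := option 'I_(k - 1)) (A := 'I_1) (GD_k1 k) _ (card_ord 1)).
  by rewrite card_option card_ord; lia.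
set M := trunc _ _ in dec0 part0 B' dec' part'.
pose W : finType := (option (M * 'I_(k - 1)) * 'I_1)%type.
have W1 (x y : W) : x != y -> x.1 != y.1.
  by case: x y => [x i] [y j]; rewrite (ord1 i) (ord1 j) xpair_eqE eqxx andbT.
apply: (@PBD_transport k d _ W B').
- by rewrite card_prod card_option card_prod !card_ord muln1 card_trunc cU cZ.
- case: dec' => h1 h2 h3 h4; split=> // x y nxy _; apply: h3 => //; exact: W1.
(* The point at infinity is placed over the origin, so it belongs to every lifted hyperplane. *)
pose pr (w : W) : P := if w.1 is Some m then (val m.1).1 else 0%R.
move=> Y cY; have [|u u0 uP] := @hyperplane_through F d [seq pr w | w <- enum Y].
  by rewrite size_map -cardE.
exists [set w | pr w *m u == 0]%R; split.
- move=> b w1 w2 bB' n12 w1b w2b; rewrite !inE => /eqP w1u /eqP w2u.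
  apply/subsetP => w wb; rewrite inE; apply/eqP.
  have [[b0 b0B eb]|[i hi]] := part' b bB'.
    move: w1b w2b wb; rewrite eb => /imsetP[x1 x1b e1] /imsetP[x2 x2b e2] /imsetP[x xb ex].
    have prE z : pr (Some (z.1, z.2.1), z.2.2) = (val z.1).1 by [].
    have n12' : x1 != x2 by apply: contraNneq n12 => e; rewrite e1 e2 e.
    have nm : x1.1 != x2.1 by case: dec0 => _ h _ _; apply: h b0B x1b x2b n12'.
    rewrite ex prE; rewrite e1 prE in w1u; rewrite e2 prE in w2u.
    have [[l ll [hl hinj]]|same] := part0 b0 b0B; last by rewrite (same x x1).
    apply: (line_hyperplane ll _ (hl _ x1b) (hl _ x2b) w1u w2u (hl _ xb)).
    by apply: contra_neq nm; apply: hinj.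
  case ew: w.1 => [[j a]|]; last by rewrite /pr ew mul0mx.
  have ij := hi w j a wb ew.
  (* In a block made of a group and infinity, one of the two distinct given points is finite, and it
     projects to the same point of [P] as [w]. *)
  have [w' [w'b w'u [a' ew']]] : exists w', [/\ w' \in b, (pr w' *m u = 0)%R & exists a', w'.1 = Some (i, a')].
    case e1: w1.1 => [[j1 a1]|].
      by exists w1; split=> //; exists a1; rewrite e1 (hi w1 j1 a1).
    case e2: w2.1 => [[j2 a2]|].
      by exists w2; split=> //; exists a2; rewrite e2 (hi w2 j2 a2).
    by have := W1 _ _ n12; rewrite e1 e2 eqxx.
  by move: w'u; rewrite /pr ew ew' /= ij.
(* A basis vector at a nonzero coordinate of [u] is off the hyperplane. It differs from the origin,
   so its whole fibre survives the truncation. *)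
- have [j uj] : exists j, u j 0%R != 0%R.
    apply/existsP; apply: contraNT u0; rewrite negb_exists => /forallP h.
    by apply/eqP/matrixP => i j; rewrite (ord1 j) mxE; apply/eqP; have := h i; rewrite negbK.
  pose x : P := delta_mx 0%R j.
  have xu : (x *m u != 0)%R.
    rewrite /x -rowE; apply: contra_neq uj => /matrixP/(_ 0%R 0%R); by rewrite !mxE.
  have x0 : x != 0%R by apply: contra_neq xu => ->; rewrite mul0mx.
  have hx : ((x, 0%R : 'Z_n).1 != 0%R) || ((x, 0%R : 'Z_n).2 \in U) by rewrite x0.
  have k10 : 0 < k - 1 by lia.
  apply/eqP => /setP/(_ (Some (exist _ (x, 0%R) hx, Ordinal k10), ord0)).
  by rewrite !inE /pr /= (negPf xu).
- apply/subsetP => w wY; rewrite inE; apply/eqP/uP/mapP; exists w => //.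
  by rewrite mem_enum.
Qed.

Theorem theorem2 (k d : nat) (hk : 2 <= k) (hd : 1 <= d) :
  exists v0 : nat, forall v : nat, v0 <= v ->
    (v - 1) %% (k - 1) = 0 ->
    (v * (v - 1)) %% (k * (k - 1)) = 0 ->
    exists B : {set {set 'I_v}}, is_PBD_k k B /\ dim_at_least B d.
Proof.
have [L [L0 kL hL]] := GD_two_classes hk.
(* With [q = x * L + 1] both line sizes, [q] and [q - 1], fall into the two classes of
   [GD_two_classes]; the lower bound on [q] gives [k.+2 <= x]. *)
have [p [e [pp e0 bq dq]]] := prime_power_mod (k.+2 * L).+1 L0.
have [F _ cF] := pPrimePowerField pp e0.
have [x ex] := dvdnP dq.
have q1 : #|F| = (x * L).+1 by rewrite cF -ex; lia.
have kx : k.+2 <= x by rewrite -(leq_pmul2r L0) -ex; lia.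
pose p0 := #|{: 'rV[F]_d.+1}|; pose S := p0.-1.
have p0E : p0 = #|F| ^ d.+1 by rewrite /p0 card_mx mul1n.
have [y eS] : exists y, S = L * y.
  exists (x * (\sum_(i < d.+1) #|F| ^ (d - i))).
  have := subn_exp #|F| 1 d.+1; rewrite exp1n -p0E subn1 -/S {1}q1 subn1 /= => ->.
  by rewrite mulnA [L * x]mulnC; congr (_ * _); apply: eq_bigr => i _; rewrite exp1n muln1.
have S0 : 0 < S.
  rewrite /S -ltnS prednK; last by rewrite p0E expn_gt0 q1.
  rewrite p0E -{1}(exp1n d.+1) ltn_exp2r // q1; nia.
have f0 := fact_gt0 p0; set f := p0`! in f0.
have LfS0 : 0 < S * (L * f) by rewrite !muln_gt0 S0 L0.
(* One design is fixed for each admissible residue, so the possible truncations [t] are bounded by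
   [tm]. The factor [f] in the modulus provides coprimality of [n], and [L] puts [n] in the class of
   1. *)
have /fin_all_exists[t tP] : forall i : 'I_(S * (L * f)), exists t, k %| i * (i - 1) ->
    GD k t (k - 1) /\ t = i %[mod S * (L * f)].
  move=> i; case: (boolP (k %| i * (i - 1))) => [di|_]; last by exists 0.
  by have [t tP] := GD_representative hk di LfS0; exists t.
pose tm := \sum_i t i; pose b := tm + k.+2 * L + 2.
(* This bound ensures [t0 <= r - S] and [b <= n]; in turn [b] dominates [t0], the threshold
   [k.+2 * L] and 2. *)
exists ((k - 1) * (S * b + S + tm) + 2) => v vbig.
move=> /eqP; rewrite -/(dvdn _ _) => /dvdnP[r er] /eqP; rewrite -/(dvdn _ _) => dv.
have ev : v = (r * (k - 1)).+1.
  by rewrite -er subn1 prednK // (leq_trans _ vbig) // addn2.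
have rbig : S * b + S + tm <= r.
  rewrite -(@leq_pmul2l (k - 1)) ?subn_gt0 // [_ * r]mulnC -er.
  by move: ((k - 1) * _) vbig => X; clear; lia.
have Sr : S + tm <= r by apply: leq_trans rbig; rewrite -addnA leq_addl.
have {}Sr0 : S <= r by apply: leq_trans Sr; apply: leq_addr.
have dr : k %| r * (r - 1).
  move: dv; rewrite ev [_.+1 - 1]subn1 /= mulnA dvdn_pmul2r ?subn_gt0 // => dv.
  have : k %| (r * (k - 1)).+1 * r + r * (r - 1).
    have -> : (r * (k - 1)).+1 * r + r * (r - 1) = k * (r * r).
      move: (hk); case: (k) => // k' _; case: (r) => [|r']; rewrite ?muln0 //.
      by rewrite !subn1 /=; ring.
    exact: dvdn_mulr.
  by rewrite dvdn_addr.
(* The target is [r = S * (1 + L * f * z) + t0], so [t0] must have the residue of [r - S]; this is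
   admissible because [k] divides [S]. *)
have lti : (r - S) %% (S * (L * f)) < S * (L * f) by rewrite ltn_mod.
have di : k %| (Ordinal lti) * (Ordinal lti - 1).
  apply: admissible_mod dr => /=.
  have kS : k %| S by rewrite eS dvdn_mulr.
  rewrite modn_dvdm; last by rewrite dvdn_mulr.
  by rewrite -{1}(subnK Sr0) -modnDmr (eqP kS) addn0.
have [gt et] := tP _ di; set t0 := t (Ordinal lti) in gt et.
have t0m : t0 <= tm by rewrite /tm (bigD1 (Ordinal lti)) //= leq_addr.
have [z ez] : exists z, r = S * (1 + L * f * z) + t0.
  have tr : t0 <= r - S by rewrite leq_subRL // (leq_trans _ Sr) // leq_add2l.
  move/eqP: et; rewrite /= modn_mod eq_sym eqn_mod_dvd //.
  case/dvdnP=> z ez; exists z.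
  by rewrite mulnDr muln1 mulnA [_ * z]mulnC -ez -addnA subnK // subnKC.
set n := 1 + L * f * z in ez.
have nb : b <= n.
  rewrite -(leq_pmul2l S0); move: rbig; rewrite ez.
  by move: (S * b) (S * n) => X Y; clear -t0m; lia.
have gn : GD k n (k - 1).
  have en : n = (f * z * L).+1 by rewrite /n; ring.
  rewrite en; case: (hL (f * z)) => //; rewrite -(leq_pmul2r L0).
  by move: nb; rewrite en /b; move: (k.+2 * L) (f * z * L) => X Y; clear; lia.
have bt : t0 <= b by rewrite /b -addnA (leq_trans t0m) // leq_addr.
have [gq1 gq] := hL x kx.
have := @PBD_of_parameters k d n t0 F hk _ _ _ gn gt; rewrite q1 /= => /(_ _ _ _ gq gq1).
rewrite -/p0 -/S -ez -ev; apply.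
- by apply: leq_trans nb; rewrite /b addn2.
- by rewrite coprime_sym /coprime -/f /n [L * f]mulnC -mulnA mulnC addnC gcdnMDl gcdn1.
- exact: leq_trans nb.
Qed.
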